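(* Let $G$ be a group in the class $\mathcal{C}$, i.e. a group that admits a coherent action on $\mathbf{R}$. Then: (1) $G$ contains a subgroup isomorphic to Thompson's group $F$. Therefore $G$ is not elementary amenable (in particular, $G$ is not solvable). (2) There exists an $n\in\mathbf{N}$ (depending on $G$) such that every proper quotient of $G$ is solvable of degree (derived length) at most $n$. (3) There exists an $n\in\mathbf{N}$ (depending on $G$) such that the $n$-th derived subgroup $G^{(n)}$ is simple.
   Context: $\mathrm{Homeo}^+(\mathbf{R})$ is the group of orientation preserving homeomorphisms of $\mathbf{R}$. Actions are right actions, $x\mapsto x\cdot g$. A group action $G<\mathrm{Homeo}^+(\mathbf{R})$ means a subgroup of $\mathrm{Homeo}^+(\mathbf{R})$ (so the action is faithful). An element has trivial germ at $+\infty$ (resp. $-\infty$) if it fixes each point of $(r,\infty)$ (resp. $(-\infty,r)$) for some $r\in\mathbf{R}$. The group of germs of $G$ at $+\infty$ (resp. $-\infty$) is the quotient of $G$ by the normal subgroup of elements with trivial germ at $+\infty$ (resp. $-\infty$). The action $G<\mathrm{Homeo}^+(\mathbf{R})$ is coherent if: (i) it is minimal, i.e. all orbits are dense in $\mathbf{R}$; (ii) the groups of germs at $+\infty$ and at $-\infty$ are solvable; (iii) there exists an element of $G$ that has trivial germ at $-\infty$ and does not fix any point in some interval $(r,\infty)$; (iv) there exists an element of $G$ that has trivial germ at $+\infty$ and does not fix any point in some interval $(-\infty,s)$. $\mathcal{C}$ is the class of groups isomorphic to the underlying group of some coherent action on $\mathbf{R}$. Thompson's group $F$ is the group of orientation preserving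 piecewise linear homeomorphisms of $[0,1]$ with finitely many breakpoints, all dyadic rationals, and whose derivatives, wherever they exist, are powers of $2$. A proper quotient is a quotient by a nontrivial normal subgroup. *)

(* Defs.v *)
From HB Require Import structures.
From mathcomp Require Import all_boot all_order all_algebra.
From mathcomp Require Import all_classical all_reals topology normedtype.

Set Implicit Arguments.
Unset Strict Implicit.
Unset Printing Implicit Defensive.

Import Order.TTheory GRing.Theory Num.Theory.
Import numFieldNormedType.Exports.

Local Open Scope classical_set_scope.
Local Open Scope ring_scope.
Local Open Scope group_scope.

Section Subgroups.
Variable G : groupType.

Definition is_subgroup (H : set G) : Prop :=
  H 1 /\ forall x y, H x -> H y -> H (x / y).

Record subgroup : Type :=
  Subgroup { subgroup_set :> set G ; subgroupP : is_subgroup subgroup_set }.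

Lemma subgroup1 (H : subgroup) : subgroup_set H 1.
Proof. by case: (subgroupP H). Qed.

Lemma subgroupF (H : subgroup) x y : subgroup_set H x -> subgroup_set H y -> subgroup_set H (x / y).
Proof. by case: (subgroupP H) => _; apply. Qed.

Lemma subgroupV (H : subgroup) x : subgroup_set H x -> subgroup_set H x^-1.
Proof. by move=> Hx; rewrite -[x^-1]mul1g; apply: subgroupF (subgroup1 H) Hx. Qed.

Lemma subgroupM (H : subgroup) x y : subgroup_set H x -> subgroup_set H y -> subgroup_set H (x * y).
Proof. by move=> Hx /subgroupV Hy; rewrite -[y]invgK; apply: subgroupF. Qed.

Lemma subgroup_inj (H K : subgroup) : H = K :> set G -> H = K.
Proof.
case: H K => [H pH] [K pK] /= eHK; case: _ / eHK in pK *.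
by congr Subgroup; apply: Prop_irrelevance.
Qed.

Lemma subgroup_closed (H : subgroup) :
  group_closed (fun x => x \in (H : set G)).
Proof.
split; first by apply/mem_set/subgroup1.
by move=> x y /set_mem Hx /set_mem Hy; apply/mem_set/subgroupF.
Qed.

End Subgroups.

HB.instance Definition _ (G : groupType) (H : subgroup G) :=
  SubChoice_isSubGroup.Build G _ {x : G | x \in subgroup_set H} (subgroup_closed H).

Section Normal.
Variable G : groupType.

Definition is_normal (N : set G) : Prop := forall x g, N x -> N (x ^ g).

Record normalSubgroup : Type := NormalSubgroup
  { normal_subgroup :> subgroup G ; normalP : is_normal (subgroup_set normal_subgroup) }.

End Normal.

Section Quotient.
Variables (G : groupType) (N : normalSubgroup G).
Local Open Scope quotient_scope.

Definition coset_rel (x y : G) : bool := (x / y) \in (N : set G).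

Lemma coset_relP x y : reflect (subgroup_set N (x / y)) (coset_rel x y).
Proof. by apply: (iffP idP) => [/set_mem|/mem_set]. Qed.

Lemma coset_rel_equiv : equiv_class_of coset_rel.
Proof.
split=> [x|x y|y x z].
- by apply/coset_relP; rewrite mulgV; apply: subgroup1.
- by apply/coset_relP/coset_relP => /subgroupV; rewrite invgF.
move=> /coset_relP xy /coset_relP yz; apply/coset_relP.
by rewrite -[x](mulgVK y) -mulgA; apply: subgroupM.
Qed.

Canonical coset_rel_equiv_rel := EquivRelPack coset_rel_equiv.
Canonical coset_rel_encModRel := defaultEncModRel coset_rel.

Definition quotientGroup : Type := {eq_quot coset_rel}.

HB.instance Definition _ : EqQuotient G coset_rel quotientGroup :=
  EqQuotient.on quotientGroup.
HB.instance Definition _ := Choice.on quotientGroup.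

Definition quotient_one : quotientGroup := lift_cst quotientGroup 1.
Definition quotient_mul := lift_op2 quotientGroup *%g.
Definition quotient_inv := lift_op1 quotientGroup (fun x : G => x^-1).

Canonical pi_quotient_one_morph := PiConst quotient_one.

Lemma pi_quotient_mul : {morph \pi_quotientGroup : x y / x * y >-> quotient_mul x y}.
Proof.
move=> x y; unlock quotient_mul; apply/eqP; rewrite piE.
apply/coset_relP.
have /eqmodP/coset_relP nx : x = repr (\pi_quotientGroup x) %[mod quotientGroup] by rewrite reprK.
have /eqmodP/coset_relP ny : y = repr (\pi_quotientGroup y) %[mod quotientGroup] by rewrite reprK.
set x' := repr _ in nx *; set y' := repr _ in ny *.
have -> : (x * y) / (x' * y') = ((y / y') ^ x^-1) * (x / x').
  by rewrite /conjg invgK invgM !mulgA mulgVK.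
by apply: subgroupM => //; apply: normalP.
Qed.
Canonical pi_quotient_mul_morph := PiMorph2 pi_quotient_mul.

Lemma pi_quotient_inv : {morph \pi_quotientGroup : x / x^-1 >-> quotient_inv x}.
Proof.
move=> x; unlock quotient_inv; apply/eqP; rewrite piE.
apply/coset_relP.
have /eqmodP/coset_relP nx : x = repr (\pi_quotientGroup x) %[mod quotientGroup] by rewrite reprK.
set x' := repr _ in nx *.
have -> : x^-1 / x'^-1 = ((x / x')^-1) ^ x.
  by rewrite /conjg invgM !invgK -!mulgA mulVg mulg1.
by apply: normalP; apply: subgroupV.
Qed.
Canonical pi_quotient_inv_morph := PiMorph1 pi_quotient_inv.

Lemma quotient_mulA : associative quotient_mul.
Proof. by move=> x y z; rewrite -[x]reprK -[y]reprK -[z]reprK !piE mulgA. Qed.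
Lemma quotient_mul1 : left_id quotient_one quotient_mul.
Proof. by move=> x; rewrite -[x]reprK !piE mul1g. Qed.
Lemma quotient_mulr1 : right_id quotient_one quotient_mul.
Proof. by move=> x; rewrite -[x]reprK !piE mulg1. Qed.
Lemma quotient_mulV : left_inverse quotient_one quotient_inv quotient_mul.
Proof. by move=> x; rewrite -[x]reprK !piE mulVg. Qed.
Lemma quotient_mulrV : right_inverse quotient_one quotient_inv quotient_mul.
Proof. by move=> x; rewrite -[x]reprK !piE mulgV. Qed.

HB.instance Definition _ := isGroup.Build quotientGroup
  quotient_mulA quotient_mul1 quotient_mulr1 quotient_mulV quotient_mulrV.

End Quotient.

Definition isomorphic (G H : groupType) : Prop :=
  exists f : {multiplicative G -> H}, bijective f.

Section DerivedSeries.
Variable G : groupType.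

Lemma generated_is_subgroup (A : set G) : is_subgroup (smallest (@is_subgroup G) A).
Proof.
split; first by move=> H [[H1 _] _].
by move=> x y Ax Ay H [sH AH]; apply: sH.2; [apply: Ax|apply: Ay].
Qed.

Definition generated (A : set G) : subgroup G := Subgroup (generated_is_subgroup A).

Lemma full_is_subgroup : is_subgroup [set: G].
Proof. by []. Qed.

Definition commutator (H : subgroup G) : subgroup G :=
  generated [set [~ x, y] | x in (H : set G) & y in (H : set G)].

Definition derived (n : nat) : subgroup G :=
  iter n commutator (Subgroup full_is_subgroup).

Definition solvable_of_degree_le (n : nat) : Prop :=
  (derived n : set G) = [set 1].

Definition solvable : Prop := exists n, solvable_of_degree_le n.

Definition simple : Prop :=
  [set: G] <> [set 1] /\
  forall N : normalSubgroup G, (N : set G) = [set 1] \/ (N : set G) = setT.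

End DerivedSeries.

(* M. Day's class: the smallest class of groups containing finite and abelian
   groups and closed under isomorphism, subgroups, quotients, extensions and
   directed unions. *)
Inductive elementary_amenable : groupType -> Prop :=
| EA_finite (G : groupType) : finite_set [set: G] -> elementary_amenable G
| EA_abelian (G : groupType) :
    (forall x y : G, x * y = y * x) -> elementary_amenable G
| EA_isomorphic (G H : groupType) :
    isomorphic G H -> elementary_amenable G -> elementary_amenable H
| EA_subgroup (G : groupType) (H : subgroup G) :
    elementary_amenable G -> elementary_amenable H
| EA_quotient (G : groupType) (N : normalSubgroup G) :
    elementary_amenable G -> elementary_amenable (quotientGroup N)
| EA_extension (G : groupType) (N : normalSubgroup G) :
    elementary_amenable N -> elementary_amenable (quotientGroup N) ->
    elementary_amenable G
| EA_directed_union (G : groupType) (D : set (subgroup G)) :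
    (forall H K, D H -> D K ->
       exists L, [/\ D L, (H : set G) `<=` L & (K : set G) `<=` L]) ->
    \bigcup_(H in D) (H : set G) = setT ->
    (forall H, D H -> elementary_amenable H) ->
    elementary_amenable G.

Section Homeo.
Context {d : Order.disp_t} (T : POrderedTopological.type d).

Definition is_homeo (f : T -> T) : Prop :=
  [/\ continuous f, {mono f : x y / (x <= y)%O} &
      exists g, [/\ cancel f g, cancel g f & continuous g]].

(* The order-preserving (hence, on an interval, orientation-preserving)
   homeomorphisms of T.  They act on the right: x . g is [g x], so the product
   g * h is "first g, then h". *)
Record homeo : Type := Homeo { homeo_fun :> T -> T; homeoP : is_homeo homeo_fun }.

HB.instance Definition _ := gen_eqMixin homeo.
HB.instance Definition _ := gen_choiceMixin homeo.

Lemma homeo_inj (g h : homeo) : homeo_fun g =1 homeo_fun h -> g = h.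
Proof.
case: g h => [g pg] [h ph] /= /funext egh; case: _ / egh in ph *.
by congr Homeo; apply: Prop_irrelevance.
Qed.

Lemma is_homeo_id : is_homeo idfun.
Proof. by split=> [x||]; [exact: cvg_id| |exists idfun; split=> // x; exact: cvg_id]. Qed.

Lemma is_homeo_comp (g h : T -> T) : is_homeo g -> is_homeo h -> is_homeo (h \o g).
Proof.
move=> [cg ig [g' [gK g'K cg']]] [ch ih [h' [hK h'K ch']]].
split; first by move=> x; apply: continuous_comp; [apply: cg|apply: ch].
  by move=> x y; rewrite /= ih ig.
exists (g' \o h'); split; try exact: can_comp.
by move=> x; apply: continuous_comp; [apply: ch'|apply: cg'].
Qed.

Lemma homeo_inv_subproof (g : homeo) :
  exists g' : homeo, cancel (homeo_fun g) g' /\ cancel g' g.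
Proof.
case: g => [g [cg ig [g' [gK g'K cg']]]] /=.
suff pg' : is_homeo g' by exists (Homeo pg').
split=> //; last by exists g.
by move=> x y; rewrite -[in RHS](g'K x) -[in RHS](g'K y) ig.
Qed.

Definition homeo_one : homeo := Homeo is_homeo_id.
Definition homeo_mul (g h : homeo) : homeo :=
  Homeo (is_homeo_comp (homeoP g) (homeoP h)).
Definition homeo_inv (g : homeo) : homeo := projT1 (cid (homeo_inv_subproof g)).

Lemma homeo_invK (g : homeo) : cancel (homeo_fun g) (homeo_inv g).
Proof. by rewrite /homeo_inv; case: cid => ? []. Qed.
Lemma homeo_invVK (g : homeo) : cancel (homeo_fun (homeo_inv g)) g.
Proof. by rewrite /homeo_inv; case: cid => ? []. Qed.

Lemma homeo_mulA : associative homeo_mul.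
Proof. by move=> g h k; apply: homeo_inj. Qed.
Lemma homeo_mul1 : left_id homeo_one homeo_mul.
Proof. by move=> g; apply: homeo_inj. Qed.
Lemma homeo_mulr1 : right_id homeo_one homeo_mul.
Proof. by move=> g; apply: homeo_inj. Qed.
Lemma homeo_mulV : left_inverse homeo_one homeo_inv homeo_mul.
Proof. by move=> g; apply: homeo_inj => x; apply: homeo_invVK. Qed.
Lemma homeo_mulrV : right_inverse homeo_one homeo_inv homeo_mul.
Proof. by move=> g; apply: homeo_inj => x; apply: homeo_invK. Qed.

HB.instance Definition _ := isGroup.Build homeo
  homeo_mulA homeo_mul1 homeo_mulr1 homeo_mulV homeo_mulrV.

Lemma homeo1E (x : T) : (1 : homeo) x = x. Proof. by []. Qed.
Lemma homeoME (g h : homeo) (x : T) : (g * h) x = h (g x). Proof. by []. Qed.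
Lemma homeoK (g : homeo) : cancel (homeo_fun g) (homeo_fun (g^-1 : homeo)).
Proof. exact: homeo_invK. Qed.
Lemma homeoVK (g : homeo) : cancel (homeo_fun (g^-1 : homeo)) g.
Proof. exact: homeo_invVK. Qed.
Lemma homeo_le (g : homeo) : {mono homeo_fun g : x y / (x <= y)%O}.
Proof. by case: (homeoP g). Qed.

End Homeo.

Section SubspaceOrder.
Context {R : realType} (A : set R).
Implicit Types x y z : A.

Let le x y : bool := (set_val x <= set_val y)%R.
Let le_refl : reflexive le. Proof. by move=> x; apply: lexx. Qed.
Let le_anti : antisymmetric le.
Proof. by move=> x y /le_anti; apply: val_inj. Qed.
Let le_trans : transitive le.
Proof. by move=> y x z; apply: le_trans. Qed.

HB.instance Definition _ :=
  Order.Le_isPOrder.Build ring_display (set_type A) le_refl le_anti le_trans.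

End SubspaceOrder.


Section Coherent.
Context {R : realType}.

Definition trivial_germ_pinfty (g : homeo R) : Prop :=
  exists r : R, forall x : R, (r < x)%R -> g x = x.

Definition trivial_germ_ninfty (g : homeo R) : Prop :=
  exists r : R, forall x : R, (x < r)%R -> g x = x.

Lemma homeo_lt (g : homeo R) : {mono homeo_fun g : x y / (x < y)%R}.
Proof. exact: (leW_mono (@homeo_le _ _ g)). Qed.

Variable G : subgroup (homeo R).

Lemma germ_kernel_pinfty_subgroup :
  is_subgroup [set g : G | trivial_germ_pinfty (val g)].
Proof.
split; first by exists 0%R => x _; rewrite gmulf1.
move=> g h [r gr] [s hs]; exists (Num.max r s) => x.
rewrite gt_max gmulfF => /andP[/gr gx /hs hx].
by rewrite homeoME gx -[in LHS]hx homeoK.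
Qed.

Lemma germ_kernel_pinfty_normal :
  is_normal (subgroup_set (Subgroup germ_kernel_pinfty_subgroup)).
Proof.
move=> g h [r gr]; exists (val h r) => x rx.
by rewrite gmulfJ !homeoME gr ?homeoVK// -(homeo_lt (val h)) homeoVK.
Qed.

Lemma germ_kernel_ninfty_subgroup :
  is_subgroup [set g : G | trivial_germ_ninfty (val g)].
Proof.
split; first by exists 0%R => x _; rewrite gmulf1.
move=> g h [r gr] [s hs]; exists (Num.min r s) => x.
rewrite lt_min gmulfF => /andP[/gr gx /hs hx].
by rewrite homeoME gx -[in LHS]hx homeoK.
Qed.

Lemma germ_kernel_ninfty_normal :
  is_normal (subgroup_set (Subgroup germ_kernel_ninfty_subgroup)).
Proof.
move=> g h [r gr]; exists (val h r) => x xr.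
by rewrite gmulfJ !homeoME gr ?homeoVK// -(homeo_lt (val h)) homeoVK.
Qed.

Definition germs_pinfty : groupType :=
  quotientGroup (NormalSubgroup germ_kernel_pinfty_normal).

Definition germs_ninfty : groupType :=
  quotientGroup (NormalSubgroup germ_kernel_ninfty_normal).

Definition orbit (x : R) : set R := [set homeo_fun g x | g in subgroup_set G].

Definition minimal_action : Prop := forall x : R, dense (orbit x).

Definition coherent : Prop :=
  [/\ minimal_action,
      solvable germs_pinfty /\ solvable germs_ninfty,
      exists g, [/\ subgroup_set G g, trivial_germ_ninfty g &
                    exists r : R, forall x : R, (r < x)%R -> g x <> x] &
      exists g, [/\ subgroup_set G g, trivial_germ_pinfty g &
                    exists s : R, forall x : R, (x < s)%R -> g x <> x]].

End Coherent.

Definition class_C (R : realType) (G : groupType) : Prop :=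
  exists A : subgroup (homeo R), coherent A /\ isomorphic G A.

Section ThompsonF.
Variable R : realType.
Local Open Scope ring_scope.

Definition unit_interval : set R := `[0, 1].

Definition dyadic (x : R) : Prop := exists (m : int) (k : nat), x = m%:~R / 2 ^+ k.

(* f is piecewise linear with breakpoints among the elements of s, and its slope
   on each linear piece is a power of 2 (k ranges over all integers). *)
Definition thompson_on (s : seq R) (f : unit_interval -> unit_interval) : Prop :=
  forall a b : R, 0 <= a -> a < b -> b <= 1 ->
    (forall p, p \in s -> ~~ (a < p < b)) ->
    exists (k : int) (c : R), forall x : unit_interval,
      a <= set_val x <= b -> set_val (f x) = 2%:R ^ k * set_val x + c.

Definition is_thompson (f : homeo unit_interval) : Prop :=
  exists s : seq R, (forall p, p \in s -> dyadic p) /\ thompson_on s f.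

Lemma is_thompson1 : is_thompson 1%g.
Proof.
exists [::]; split=> // a b _ _ _ _; exists 0, 0 => x _.
by rewrite homeo1E expr0z mul1r addr0.
Qed.

Lemma dyadic0 : dyadic 0.
Proof. by exists 0, 0%N; rewrite mul0r. Qed.

Lemma dyadicD x y : dyadic x -> dyadic y -> dyadic (x + y).
Proof.
move=> [m [k ->]] [n [l ->]]; exists (m * 2 ^+ l + n * 2 ^+ k), (k + l)%N.
by rewrite addf_div ?expf_neq0 ?pnatr_eq0// rmorphD !rmorphM !rmorphXn -exprD.
Qed.

Lemma dyadicN x : dyadic x -> dyadic (- x).
Proof. by move=> [m [k ->]]; exists (- m), k; rewrite rmorphN mulNr. Qed.

Lemma dyadicMz x (k : int) : dyadic x -> dyadic (2%:R ^ k * x).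
Proof.
move=> [m [l ->]]; case: k => k.
  exists (2 ^+ k * m), l; rewrite rmorphM rmorphXn /= -exprnP.
  by rewrite mulrA.
exists m, (k.+1 + l)%N.
by rewrite NegzE -exprnN exprD invfM mulrCA.
Qed.

Implicit Types (f g : homeo unit_interval) (x y : unit_interval).

Lemma unitP x : 0 <= set_val x <= 1.
Proof. by have := set_valP x; rewrite /unit_interval /= in_itv. Qed.

Lemma unit_point (r : R) : 0 <= r <= 1 -> {x : unit_interval | set_val x = r}.
Proof.
move=> r01; have rI : r \in unit_interval by rewrite inE /unit_interval /= in_itv.
by exists (SigSub rI).
Qed.

Definition point (r : R) : unit_interval :=
  if pselect (0 <= r <= 1) is left r01 then projT1 (unit_point r01)
  else projT1 (@unit_point 0 ltac:(by rewrite lexx ler01)).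

Lemma pointK r : 0 <= r <= 1 -> set_val (point r) = r.
Proof. by rewrite /point; case: pselect => // p _; case: unit_point. Qed.

Lemma point_dyadic r : dyadic r -> dyadic (set_val (point r)).
Proof.
rewrite /point; case: pselect => p; case: unit_point => x /= -> //.
by move=> _; apply: dyadic0.
Qed.

Lemma unit_homeo_le f x y :
  (set_val (f x) <= set_val (f y)) = (set_val x <= set_val y).
Proof. exact: (homeo_le f x y). Qed.

Lemma unit_homeo_lt f x y :
  (set_val (f x) < set_val (f y)) = (set_val x < set_val y).
Proof. by rewrite !ltNge unit_homeo_le. Qed.

Lemma unit_homeo0 f x : set_val x = 0 -> set_val (f x) = 0.
Proof.
move=> x0; apply/eqP; rewrite eq_le (andP (unitP (f x))).1 andbT.
have := unit_homeo_le f x (homeo_fun (f^-1)%g x).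
by rewrite homeoVK x0 => ->; case/andP: (unitP (homeo_fun (f^-1)%g x)).
Qed.

Lemma exists_left_breakpoint (s : seq R) (r : R) : 0 < r ->
  exists p, [/\ p = 0 \/ p \in s, 0 <= p < r &
                forall q, q \in s -> ~~ (p < q < r)].
Proof.
move=> r0; elim: s => [|q s [p [ps pr ph]]]; first by exists 0; split=> //; [left|rewrite lexx].
case: (boolP (p < q < r)) => [/andP[pq qr]|npq].
  exists q; split; first by right; rewrite mem_head.
    by rewrite qr (le_trans _ (ltW pq))//; case/andP: pr.
  move=> u; rewrite in_cons => /orP[/eqP->|us]; first by rewrite ltxx.
  by apply: contra (ph _ us) => /andP[qu ->]; rewrite (lt_trans pq).
exists p; split=> //; first by case: ps; [left|right; rewrite in_cons; apply/orP; right].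
by move=> u; rewrite in_cons => /orP[/eqP->|/ph].
Qed.

Lemma thompson_dyadic (s : seq R) f : (forall p, p \in s -> dyadic p) ->
  thompson_on s f -> forall x, dyadic (set_val x) <-> dyadic (set_val (f x)).
Proof.
move=> ds fs x; have [n] := ubnP (count (fun q => q < set_val x) s).
elim: n x => // n IH x ltn.
have /andP[] := unitP x; rewrite le_eqVlt => /orP[/eqP x0 _|x0 x1].
  by rewrite (unit_homeo0 f) -?x0.
have [p [ps /andP[p0 px] ph]] := exists_left_breakpoint s x0.
have p01 : 0 <= p <= 1 by rewrite p0 (le_trans (ltW px)).
have [k [c fE]] := fs _ _ p0 px x1 ph.
have dp : dyadic p by case: ps => [->|/ds//]; apply: dyadic0.
have dfp : dyadic (set_val (f (point p))).
  case: ps => [p_eq0|ps]; first by rewrite unit_homeo0 ?pointK//; exact: dyadic0.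
  apply: (IH (point p) _).1; rewrite ?pointK//.
  rewrite -ltnS; apply: leq_trans ltn; rewrite ltnS.
  elim: (s) ps => //= q t IHt; rewrite in_cons => /orP[/eqP<-|/IHt {}IHt].
    rewrite ltxx px add0n add1n ltnS; apply: sub_count => q' /= ?.
    exact: lt_trans px.
  rewrite -addnS leq_add//.
  by case: (ltP q p) => // qp; rewrite (lt_trans qp px).
have fp := fE (point p); rewrite pointK// lexx ltW//= in fp.
have fx := fE x; rewrite lexx ltW//= in fx.
have k0 : (2%:R : R) ^ k != 0 by rewrite expfz_neq0 ?pnatr_eq0.
split=> [dx|dfx].
  have -> : set_val (f x) = 2%:R ^ k * (set_val x - p) + set_val (f (point p)).
    by rewrite fx// fp// mulrBr addrA subrK.
  by apply: dyadicD => //; apply/dyadicMz/dyadicD => //; apply: dyadicN.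
have -> : set_val x = 2%:R ^ (- k) * (set_val (f x) - set_val (f (point p))) + p.
  by rewrite fx// fp// opprD addrACA subrr addr0 -mulrBr -invr_expz mulrA mulVf// mul1r subrK.
by apply: dyadicD => //; apply/dyadicMz/dyadicD => //; apply: dyadicN.
Qed.

Lemma is_thompsonV f : is_thompson f -> is_thompson (f^-1)%g.
Proof.
move=> [s [ds fs]].
exists [seq set_val (f (point p)) | p <- s]; split.
  move=> _ /mapP[p ps ->]; apply: (thompson_dyadic ds fs (point p)).1.
  exact/point_dyadic/ds.
move=> a b a0 ab b1 nab.
have ea : set_val (point a) = a by rewrite pointK// a0 (le_trans (ltW ab)).
have eb : set_val (point b) = b by rewrite pointK// b1 (le_trans a0 (ltW ab)).
set A := homeo_fun (f^-1)%g (point a); set B := homeo_fun (f^-1)%g (point b).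
have fA : set_val (f A) = a by rewrite homeoVK.
have fB : set_val (f B) = b by rewrite homeoVK.
have AB : set_val A < set_val B by rewrite -(unit_homeo_lt f) fA fB.
have A0 : 0 <= set_val A by case/andP: (unitP A).
have B1 : set_val B <= 1 by case/andP: (unitP B).
have [|k [c fE]] := fs _ _ A0 AB B1.
  move=> p ps; apply/negP => /andP[Ap pB].
  have p01 : 0 <= p <= 1 by rewrite (le_trans A0 (ltW Ap)) (le_trans (ltW pB) B1).
  have /negP[] := nab (set_val (f (point p))) (map_f _ ps).
  by rewrite -{1}fA -{1}fB !unit_homeo_lt pointK// Ap.
exists (- k), (- (2%:R ^ (- k) * c)) => x /andP[ax xb].
have k0 : (2%:R : R) ^ k != 0 by rewrite expfz_neq0 ?pnatr_eq0.
have := fE (homeo_fun (f^-1)%g x).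
rewrite homeoVK !unit_homeo_le ea eb ax xb => -> //.
by rewrite -mulrBr addrK mulrA -invr_expz mulVf// mul1r.
Qed.

Lemma is_thompsonM f g : is_thompson f -> is_thompson g -> is_thompson (f * g)%g.
Proof.
move=> [s [ds fs]] [t [dt gt]].
exists (s ++ [seq set_val (homeo_fun (f^-1)%g (point p)) | p <- t]); split.
  move=> p; rewrite mem_cat => /orP[/ds//|/mapP[q qt ->]].
  by apply: (thompson_dyadic ds fs _).2; rewrite homeoVK; exact/point_dyadic/dt.
move=> a b a0 ab b1 nab.
have ea : set_val (point a) = a by rewrite pointK// a0 (le_trans (ltW ab)).
have eb : set_val (point b) = b by rewrite pointK// b1 (le_trans a0 (ltW ab)).
have [|k [c fE]] := fs _ _ a0 ab b1.
  by move=> p ps; apply: nab; rewrite mem_cat ps.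
set A := f (point a); set B := f (point b).
have AB : set_val A < set_val B by rewrite unit_homeo_lt ea eb.
have A0 : 0 <= set_val A by case/andP: (unitP A).
have B1 : set_val B <= 1 by case/andP: (unitP B).
have [|l [e gE]] := gt _ _ A0 AB B1.
  move=> p pt; apply/negP => /andP[Ap pB].
  have p01 : 0 <= p <= 1 by rewrite (le_trans A0 (ltW Ap)) (le_trans (ltW pB) B1).
  have /negP[] := nab (set_val (homeo_fun (f^-1)%g (point p))) ltac:(by rewrite mem_cat (map_f _ pt) orbT).
  by rewrite -{1}ea -{1}eb -(unit_homeo_lt f (point a)) -(unit_homeo_lt f _ (point b)) homeoVK pointK// Ap.
exists (l + k), (2%:R ^ l * c + e) => x axb; rewrite homeoME gE.
  by rewrite fE// mulrDr mulrA -expfzDr ?pnatr_eq0// addrA.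
by rewrite !unit_homeo_le ea eb.
Qed.

Lemma thompson_is_subgroup : is_subgroup [set f | is_thompson f].
Proof.
split; first exact: is_thompson1.
by move=> f g hf hg; apply: is_thompsonM hf (is_thompsonV hg).
Qed.

Definition thompsonF : subgroup (homeo unit_interval) :=
  Subgroup thompson_is_subgroup.

End ThompsonF.

(* Main.v *)
From HB Require Import structures.
Require Import Defs.
From mathcomp Require Import all_boot all_order all_algebra.
From mathcomp Require Import all_classical all_reals topology normedtype.
From mathcomp Require Import ring lra zify.

Set Implicit Arguments.
Unset Strict Implicit.
Unset Printing Implicit Defensive.

Import Order.TTheory GRing.Theory Num.Theory.
Import numFieldNormedType.Exports.

Local Open Scope classical_set_scope.

(** Groups act on the right, so in [g * h] the factor [g] acts first.

    Thompson's group.  Let [u] move only points left of [q] and [v] only points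
    right of [p], where [p < q], and suppose that [u * v] sends [p] to the right
    of [q] and that [v] moves [q] to the right (a [thompson_pair]).  Put
    [X_0 = u v] and [X_(i+1) = v ^ (X_0 ^+ i)].  The support of [u] is disjoint
    from the support of [X_j] for [j >= 2], and that alone forces the relations
    [X_j X_i = X_i X_(j+1)] for [i < j] ([thompson_pair_shifting]).  The
    relations allow one to sort a positive word, and two different sorted words
    have different values, because there is a point [z_i] that [X_i] moves to
    the right and that all later letters fix ([thompson_pair_separating]).  The
    relations also give common right multiples.  Therefore the fractions of
    positive words multiply and compare in the same way for every Thompson pair
    ([fraction_embedding]).  The group [F] has a Thompson pair of its own, and
    each of its elements is a fraction: it maps a dyadic subdivision of [0, 1]
    to another one, and a positive element carries any dyadic subdivision to the
    one cut at [1 - 2^-i] ([forest_to_vine], [thompson_fractions]).  So [F] embeds into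
    every group that has a Thompson pair.  In a coherent action, the elements
    given by the axioms at the two ends of the line yield such a pair after a
    conjugation that makes their supports overlap.

    Normal subgroups.  Minimality and those same two elements compress any
    bounded interval into any other ([two_step_compression]).  Let [N] be a
    nontrivial normal subgroup.  Some element of [N] displaces an interval,
    hence, by conjugation, elements of [N] displace any bounded interval
    ([normal_displaces]).  Then [k * k^-1 ^ y], with [y] in [N] displacing far
    enough, is an element of [N] that agrees with [k] on a prescribed half-line,
    so [N] compresses intervals as well ([normal_compresses]).  If [m] displaces
    an interval that supports [g] and [h], then [[~ [~ m, g], h] = [~ g, h]]; with
    the compression, [N] contains the commutators of all compactly supported
    elements ([normalized_commutator]).  Since the groups of germs are solvable,
    some derived subgroup of index [k] has compact supports, and the next one,
    [H], lies in every [N].  This bounds the derived length of the quotients.  The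
    same commutator argument inside [H], which compresses, shows that a
    nontrivial normal subgroup of [H] contains the derived subgroup of [H].  That
    one is again normal and nontrivial in the whole group, so it contains [H].
    Hence [H] is simple.

    Amenability.  The groups no subgroup of which maps onto [F] are stable under
    all the operations that generate the elementary amenable groups.  The
    essential case is an extension: if a subgroup maps onto [F], then either its
    part inside the kernel dies, and the quotient has a subgroup that maps onto
    [F], or that part maps onto a nontrivial normal subgroup of [F].  The action
    of [F] on the open unit interval satisfies the dynamical hypotheses above, so
    such a normal subgroup contains a Thompson pair and therefore a copy of [F]. *)

(** * Positive words and the relations of Thompson's group *)

Section PositiveWords.
Local Open Scope group_scope.
Implicit Types (K : groupType) (p q w : seq nat) (i j k : nat).

Definition shifting K (X : nat -> K) : Prop :=
  forall i j, i < j -> X j * X i = X i * X j.+1.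

Definition eval_word K (X : nat -> K) w : K := foldr (fun i g => X i * g) 1 w.

Lemma eval_word_cat K (X : nat -> K) p q : eval_word X (p ++ q) = eval_word X p * eval_word X q.
Proof. by elim: p => [|i p IHp] /=; rewrite ?mul1g// IHp mulgA. Qed.

(** Equality of positive words as a consequence of the relations: it transfers an
    identity found in one group to every other group. *)
Definition word_equiv p q : Prop :=
  forall K (X : nat -> K), shifting X -> eval_word X p = eval_word X q.

(** A letter moves to the right past a smaller letter and grows by one, as in
    [X_j X_i = X_i X_(j+1)]. *)
Fixpoint insert_letter i w : seq nat :=
  if w is k :: w' then
    if i <= k then i :: w else k :: insert_letter i.+1 w'
  else [:: i].

Lemma insert_letter_equiv i w : word_equiv (i :: w) (insert_letter i w).
Proof.
move=> K X sX; elim: w i => //= k w IHw i.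
by case: leqP => //= ki; rewrite -IHw /= !mulgA (sX _ _ ki).
Qed.

Lemma insert_letter_path i k w :
  k <= i -> path leq k w -> path leq k (insert_letter i w).
Proof.
elim: w i k => [|j w IHw] i k /=; first by move=> ->.
move=> ki /andP[kj jw]; case: leqP => [ij|ji] /=; first by rewrite ki ij.
by rewrite kj IHw// ltnW// ltnW.
Qed.

Definition sort_word : seq nat -> seq nat := foldr insert_letter [::].

Lemma sort_word_sorted w : sorted leq (sort_word w).
Proof.
elim: w => //= i w; case: (sort_word w) => //= k s sks.
by case: leqP => [ik|ki] /=; rewrite ?ik// insert_letter_path// ltnW// ltnW.
Qed.

Lemma sort_word_equiv w : word_equiv w (sort_word w).
Proof.
by move=> K X sX; elim: w => //= i w ->; rewrite -insert_letter_equiv.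
Qed.

Lemma letter_common_multiple i j : exists c d,
  size c <= 1 /\ word_equiv (i :: c) (j :: d).
Proof.
have [ij|ji|->] := ltngtP i j; last by exists [::], [::].
  exists [:: j.+1], [:: i]; split=> // K X sX /=.
  by rewrite !mulg1 (sX _ _ ij).
by exists [:: j], [:: i.+1]; split=> // K X sX /=; rewrite !mulg1 (sX _ _ ji).
Qed.

(** The bound on the length of [c] makes the induction go through: completing the
    square for the first letter of [p] leaves at most one letter to be matched
    with the rest of [p]. *)
Lemma word_letter_common_multiple p j : exists c d,
  size c <= 1 /\ word_equiv (p ++ c) (j :: d).
Proof.
elim: p j => [|i p IHp] j.
  exists [:: j], [::]. split=> //.
have [c [d [c1 cd]]] := letter_common_multiple i j.
case: c c1 cd => [|k []]// _ cd.
  exists [::], (d ++ p); split=> // K X sX; rewrite cats0.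
  have /= := cd K X sX; rewrite mulg1 => ->.
  by rewrite eval_word_cat mulgA.
have [c' [d' [c'1 cd']]] := IHp k.
exists c', (d ++ d'); split=> // K X sX /=.
have /= := cd K X sX; have /= -> := cd' K X sX; rewrite mulg1 mulgA => ->.
by rewrite eval_word_cat mulgA.
Qed.

Lemma common_multiple p q : exists c d, word_equiv (p ++ c) (q ++ d).
Proof.
elim: q p => [|j q IHq] p; first by exists [::], p; rewrite cats0.
have [c [d [_ cd]]] := word_letter_common_multiple p j.
have [c' [d' cd']] := IHq d.
exists (c ++ c'), d' => K X sX; rewrite catA eval_word_cat (cd K X sX) /=.
by rewrite -mulgA -eval_word_cat cd'.
Qed.

(** For a shifting sequence this says that the positive words satisfy no relations
    besides the consequences of the shift relations. *)
Definition separating K (X : nat -> K) : Prop :=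
  forall p q, sorted leq p -> sorted leq q -> eval_word X p = eval_word X q -> p = q.

Lemma separating_word_equiv K (X : nat -> K) p q :
  shifting X -> separating X -> eval_word X p = eval_word X q -> word_equiv p q.
Proof.
move=> sX uX; rewrite (sort_word_equiv p sX) (sort_word_equiv q sX).
move=> /(uX _ _ (sort_word_sorted _) (sort_word_sorted _)) pq L Y sY.
by rewrite (sort_word_equiv p sY) (sort_word_equiv q sY) pq.
Qed.

Definition fractions K (X : nat -> K) : Prop :=
  forall f, exists p q, f = eval_word X p / eval_word X q.

(** Bringing both fractions to a common denominator turns their equality into an
    equality of positive words, which [X] being separating makes formal. *)
Lemma transfer_fractions (F K : groupType) (X : nat -> F) (Y : nat -> K) p q p' q' :
  shifting X -> shifting Y -> separating X ->
  eval_word X p / eval_word X q = eval_word X p' / eval_word X q' ->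
  eval_word Y p / eval_word Y q = eval_word Y p' / eval_word Y q'.
Proof.
move=> sX sY uX eX; have [c [d cd]] := common_multiple q q'.
have epc : word_equiv (p ++ c) (p' ++ d).
  apply: (separating_word_equiv sX uX); rewrite !eval_word_cat.
  rewrite -[eval_word X p](mulgVK (eval_word X q)) eX -!mulgA -[eval_word X q * _]eval_word_cat.
  by rewrite (cd _ _ sX) eval_word_cat mulKg.
have := epc _ _ sY; have := cd _ _ sY; rewrite !eval_word_cat => eq ep.
by rewrite -(mulgKA (eval_word Y c)) ep eq mulgKA.
Qed.

Lemma fraction_mul p q p' q' : exists a b,
  forall K (X : nat -> K), shifting X ->
    (eval_word X p / eval_word X q) * (eval_word X p' / eval_word X q') =
    eval_word X a / eval_word X b.
Proof.
have [c [d cd]] := common_multiple q p'.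
exists (p ++ c), (q' ++ d) => K X sX; have := cd _ _ sX; rewrite !eval_word_cat => e.
have -> : eval_word X p' = eval_word X q * eval_word X c / eval_word X d by rewrite e mulgK.
by rewrite invgM !mulgA mulgVK.
Qed.

Lemma fraction_embedding (F K : groupType) (X : nat -> F) (Y : nat -> K) :
  shifting X -> shifting Y -> separating X -> separating Y -> fractions X ->
  exists phi : F -> K, [/\ {morph phi : x y / x * y}, injective phi &
    forall f, exists p q, phi f = eval_word Y p / eval_word Y q].
Proof.
move=> sX sY uX uY fX; have /choice[num /choice[den fE]] := fX.
exists (fun f => eval_word Y (num f) / eval_word Y (den f)); split.
- move=> f g; have [a [b ab]] := fraction_mul (num f) (den f) (num g) (den g).
  by rewrite (ab _ _ sY); apply: (transfer_fractions sX) => //; rewrite -ab// -!fE.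
- by move=> f g e; rewrite (fE f) (fE g); apply: (transfer_fractions sY).
- by move=> f; exists (num f), (den f).
Qed.

End PositiveWords.

(** * Order actions and Thompson pairs *)

Record order_action (R : realType) (K : groupType) : Type := OrderAction {
  act :> K -> R -> R;
  act1 : forall x, act 1%g x = x;
  actM : forall g h x, act (g * h)%g x = act h (act g x);
  act_le : forall g, {mono act g : x y / (x <= y)%R};
  act_faithful : forall g, (forall x, act g x = x) -> g = 1%g }.

Section OrderActions.
Variables (R : realType) (K : groupType) (A : order_action R K).
Local Open Scope group_scope.
Local Notation "x |> g" := (A g%g x) (at level 40, left associativity).
Implicit Types (x y : R) (g h : K).

Lemma act_lt g : {mono A g : x y / (x < y)%R}.
Proof. exact: leW_mono (act_le A g). Qed.

Lemma actK g x : x |> g |> g^-1 = x.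
Proof. by rewrite -actM mulgV act1. Qed.

Lemma actVK g x : x |> g^-1 |> g = x.
Proof. by rewrite -actM mulVg act1. Qed.

Lemma actJ g h x : x |> h |> g ^ h = x |> g |> h.
Proof. by rewrite !actM actK. Qed.

Lemma actJV g h x : x |> g ^ h = x |> h^-1 |> g |> h.
Proof. by rewrite !actM. Qed.

Lemma act_leV g x y : (x |> g^-1 <= y)%R = (x <= y |> g)%R.
Proof. by rewrite -(act_le A g) actVK. Qed.

Lemma act_ltV g x y : (x |> g^-1 < y)%R = (x < y |> g)%R.
Proof. by rewrite -(act_lt g) actVK. Qed.

Lemma fixV g x : x |> g = x -> x |> g^-1 = x.
Proof. by move=> {1}<-; rewrite actK. Qed.

Lemma act_ext g h : (forall x, x |> g = x |> h) -> g = h.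
Proof.
move=> gh; apply/divg1_eq/(act_faithful (o := A)) => x.
by rewrite actM gh actK.
Qed.

(** The supports lie on the two sides of [q], and both elements preserve the sides. *)
Lemma disjoint_commute (q : R) g h :
  (forall x, (x <= q)%R -> x |> g = x) -> (forall x, (q <= x)%R -> x |> h = x) ->
  g * h = h * g.
Proof.
move=> gq hq; apply: act_ext => x; rewrite !actM.
have [xq|/ltW qx] := leP x q.
  by rewrite gq// gq// -(hq q)// act_le.
by rewrite (hq x)// hq// -(gq q)// act_le.
Qed.

End OrderActions.

Section ThompsonPairs.
Variables (R : realType) (K : groupType) (A : order_action R K).
Local Open Scope group_scope.
Local Notation "x |> g" := (A g%g x) (at level 40, left associativity).

Record thompson_pair (u v : K) (p q : R) : Prop := ThompsonPair {
  tp_right : forall x, (x <= p)%R -> x |> v = x;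
  tp_left : forall x, (q <= x)%R -> x |> u = x;
  tp_reach : (q <= p |> u |> v)%R;
  tp_push : (q < q |> v)%R }.

Definition thompson_gen (u v : K) (i : nat) : K :=
  if i is j.+1 then v ^ ((u * v) ^+ j) else u * v.

Variables (u v : K) (p q : R).
Hypothesis uv : thompson_pair u v p q.

Let a := u * v.
Let X := thompson_gen u v.

Lemma thompson_pair_lt : (p < q)%R.
Proof.
rewrite ltNge; apply/negP => qp; have := tp_push uv.
by rewrite (tp_right uv)// ltxx.
Qed.

(** Since [q] is fixed by [u] and pushed to the right by [v], a point that has passed [q]
    under [u * v] stays beyond it. *)
Lemma thompson_pair_reach_iter j : (q <= p |> a ^+ j.+1)%R.
Proof.
elim: j => [|j IHj]; first by rewrite expg1 actM (tp_reach uv).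
rewrite expgSr actM; apply: (@le_trans _ _ (q |> a)); last by rewrite act_le.
by rewrite actM (tp_left uv)// ltW// (tp_push uv).
Qed.

Lemma thompson_pair_gen_fix i x : (x <= p |> a ^+ i)%R -> x |> X i.+1 = x.
Proof.
move=> xp; rewrite /X /= actJV (tp_right uv) ?actVK//.
by rewrite act_leV.
Qed.

(** Conjugation by [u * v] shifts the indices by construction.  The letters of index
    at least [2] commute with [u], so that conjugation by [v] shifts them too; the
    remaining relations are conjugates of this one. *)
Lemma thompson_pair_shifting : shifting X.
Proof.
have conj0 j : X j.+1 ^ a = X j.+2 by rewrite /X /= -conjgM -expgSr.
have conjv j : X j.+2 ^ v = X j.+3.
  rewrite -(conj0 j.+1) conjgM; congr conjg; apply/esym/conjg_fixP/commgP.
  apply: (disjoint_commute (A := A) (q := q)) (tp_left uv) => x xq.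
  by apply: thompson_pair_gen_fix; apply: le_trans (thompson_pair_reach_iter j).
move=> [|i] [|j]//; rewrite ?ltnS => ij; rewrite conjgC ?conj0//.
have shift m : X (m + i)%N.+1 = X m.+1 ^ (a ^+ i).
  by rewrite /X /= expgnDr conjgM.
congr (_ * _); have -> : j = ((j - i.+1).+1 + i)%N by rewrite addSnnS subnK.
by rewrite shift [X i.+1]/= -conjJg conjv -shift addSn.
Qed.

Lemma thompson_pair_gen_above i : (p |> a ^+ i < p |> a ^+ i.+1)%R.
Proof.
elim: i => [|i IHi]; last by rewrite (expgSr _ i) (expgSr _ i.+1) !actM !act_lt.
by rewrite expg0 act1; apply: lt_le_trans thompson_pair_lt (thompson_pair_reach_iter 0).
Qed.

(** The points are [p] and the translates of [q] by the powers of [u * v]. *)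
Lemma thompson_pair_witness i : exists z : R,
  (z < z |> X i)%R /\ forall j, (i < j)%N -> z |> X j = z.
Proof.
case: i => [|i].
  exists p; split=> [|[|j]//_]; first by have := thompson_pair_gen_above 0; rewrite expg0 act1.
  apply: thompson_pair_gen_fix; elim: j => [|j IHj]; first by rewrite expg0 act1.
  by apply: le_trans IHj _; apply/ltW/thompson_pair_gen_above.
exists (q |> a ^+ i); split=> [|[|j]//].
  by rewrite /X /= actJ act_lt (tp_push uv).
rewrite ltnS => ij; apply: thompson_pair_gen_fix.
have : (q |> a ^+ i <= p |> a ^+ i.+1)%R.
  by rewrite expgS actM act_le (thompson_pair_reach_iter 0).
move=> qi; apply: le_trans qi _; elim: j ij => // j IHj.
rewrite leq_eqVlt => /orP[/eqP<-|/IHj]; first exact: lexx.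
by move=> h; apply: le_trans h _; apply/ltW/thompson_pair_gen_above.
Qed.

(** If two sorted words begin with different letters, let [i] be the smaller of the
    two.  The word that begins with [i] moves the point of [thompson_pair_witness]
    to the right, and the other one fixes it. *)
Lemma thompson_pair_separating : separating X.
Proof.
have up i z y w : (z < z |> X i)%R -> (forall j, (i < j)%N -> z |> X j = z) ->
    all (leq i) w -> (z < y)%R -> (z < y |> eval_word X w)%R.
  move=> zi zj; elim: w y => [|j w IHw] y /=; first by rewrite act1.
  rewrite leq_eqVlt actM => /andP[/orP[/eqP<-|ij]] wi zy; apply: IHw => //.
    by apply: lt_trans zi _; rewrite act_lt.
  by rewrite -(zj j ij) act_lt.
have up1 i z w : (z < z |> X i)%R -> (forall j, (i < j)%N -> z |> X j = z) ->
    all (leq i) w -> (z < z |> eval_word X (i :: w))%R.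
  by move=> zi zj wi; rewrite /= actM; apply: (up i).
have fix_z i z w : (forall j, (i < j)%N -> z |> X j = z) ->
    all (ltn i) w -> z |> eval_word X w = z.
  move=> zj; elim: w => [|j w IHw] /=; first by rewrite act1.
  by move=> /andP[ij wi]; rewrite actM zj// IHw.
have neq i w w' : all (leq i) w -> all (ltn i) w' -> eval_word X (i :: w) <> eval_word X w'.
  move=> wi wi' e; have [z [zi zj]] := thompson_pair_witness i.
  by have := up1 i z w zi zj wi; rewrite e (fix_z i z w')// ltxx.
have ps i w : path leq i w -> all (leq i) w.
  exact: (order_path_min leq_trans).
have lt_all i j w : (i < j)%N -> path leq j w -> all (ltn i) (j :: w).
  move=> ij /ps jw; rewrite /= ij; apply: sub_all jw => k; exact: leq_trans.
elim=> [|i w IHw] [|j w'] //= iw jw'.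
- by move=> /esym /(neq j w' [::] (ps _ _ jw') isT).
- by move=> /(neq i w [::] (ps _ _ iw) isT).
have [ij|ji|<-] := ltngtP i j.
- by move=> /(neq i w (j :: w') (ps _ _ iw) (lt_all _ _ _ ij jw')).
- by move=> /esym /(neq j w' (i :: w) (ps _ _ jw') (lt_all _ _ _ ji iw)).
by move=> /mulgI /IHw ->//; apply: path_sorted; eassumption.
Qed.

End ThompsonPairs.

(** * Normal subgroups of flexible actions *)

Section Dynamics.
Variables (R : realType) (K : groupType) (A : order_action R K).
Local Open Scope ring_scope.
Local Open Scope group_scope.
Local Notation "x |> g" := (A g%g x) (at level 40, left associativity).
Implicit Types (x y z a b c d : R) (g h k m n : K) (D : set R) (S M : set K).

Definition fixes_below g r : Prop := forall x, x <= r -> x |> g = x.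
Definition fixes_above g s : Prop := forall x, s <= x -> x |> g = x.

(** The dynamical input, on an invariant convex set [D] outside of which nothing moves:
    elements supported on half-lines push points of [D] arbitrarily far down, and
    arbitrarily close to a fixed barrier [e] from below.  The barrier may be chosen in
    any interval and keeps what was pushed below it inside that interval.  Here [D] is
    the line for a coherent action and the open unit interval for Thompson's group. *)
Record flexible D : Prop := Flexible {
  flex_convex : forall x y z, D x -> D z -> x <= y <= z -> D y;
  flex_stable : forall g x, D x -> D (x |> g);
  flex_moved : forall g x, x |> g <> x -> D x;
  flex_down : forall b d, D b -> D d ->
    exists k, (exists2 r, D r & fixes_below k r) /\ b |> k < d;
  flex_up : forall c d, D c -> D d -> c < d ->
    exists e, [/\ c < e < d & forall a, D a -> a < e ->
      exists k, [/\ exists2 s, D s & fixes_above k s, e |> k = e & c < a |> k]] }.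

Definition compresses D S : Prop :=
  forall a b c d, D a -> D b -> D c -> D d -> a <= b -> c < d ->
    exists k, [/\ S k, c < a |> k & b |> k < d].

Definition compactly_supported D g : Prop :=
  exists a b, [/\ D a, D b, a <= b, fixes_below g a & fixes_above g b].

Section OnD.
Variable D : set R.
Hypothesis flexD : flexible D.

Lemma flex_max x y : D x -> D y -> D (Num.max x y).
Proof. by move=> Dx Dy; rewrite /Num.max; case: ifP. Qed.

Lemma flex_min x y : D x -> D y -> D (Num.min x y).
Proof. by move=> Dx Dy; rewrite /Num.min; case: ifP. Qed.

(** Push the interval below a barrier [e] between [c] and [d], then push it up
    towards [e].  Each step uses an element supported on a half-line, which
    [normal_compresses] needs. *)
Lemma two_step_compression a b c d :
    D a -> D b -> D c -> D d -> a <= b -> c < d ->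
  exists k l, [/\ exists2 r, D r & fixes_below k r,
    exists2 s, D s & fixes_above l s, c < a |> k |> l & b |> k |> l < d].
Proof.
move=> Da Db Dc Dd ab cd.
have [e [/andP[ce ed] up]] := flex_up flexD Dc Dd cd.
have De : D e by apply: (flex_convex flexD) Dc Dd _; rewrite !ltW.
have [k [kr bke]] := flex_down flexD Db De.
have ake : a |> k < e by apply: le_lt_trans bke; rewrite act_le.
have [l [ls le ca]] := up _ (flex_stable flexD k Da) ake.
exists k, l; split=> //; apply: le_lt_trans ed.
by rewrite -[leRHS]le act_le ltW.
Qed.

Lemma compresses_setT : compresses D setT.
Proof.
move=> a b c d Da Db Dc Dd ab cd.
have [k [l [_ _ ca bd]]] := two_step_compression Da Db Dc Dd ab cd.
by exists (k * l); rewrite !actM.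
Qed.

(** If [m] moves [x] to the right, the preimage [c] of a point [t] strictly between [x]
    and its image is to the left of [x], and [m] sends [c, t] to the right of [t]. *)
Lemma displaced_interval M : is_subgroup M -> M <> [set 1] ->
  exists m c t, [/\ M m, D c, D t, c < t & t |> m^-1 = c].
Proof.
move=> sM M1.
have [m Mm m1] : exists2 m, M m & m <> 1.
  apply: contra_notP M1 => nM; rewrite eqEsubset; split=> [m Mm|_ ->]; last exact: sM.1.
  by apply: contra_notP nM => m1; exists m.
have [x xm] : exists x, x |> m <> x.
  apply: contra_notP m1 => nx; apply: (act_faithful (o := A)) => x.
  by apply: contra_notP nx => xm; exists x.
have Dx := flex_moved flexD xm.
(* otherwise take the inverse of [m] *)
wlog lt_xm : m Mm xm {m1} / x < x |> m.
  move=> W; have [lt|gt|eq] := ltgtP x (x |> m); [exact: (W m)| |by rewrite -eq in xm].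
  have xmV : x < x |> m^-1 by rewrite -(act_lt A m) actVK.
  apply: (W m^-1) => //; last by apply/eqP; rewrite gt_eqF.
  by rewrite -[m^-1]mul1g; apply: sM.2 => //; exact: sM.1.
pose t := ((x + x |> m) / 2)%R.
have [xt tm] : x < t /\ t < x |> m by rewrite /t; split; lra.
have Dt : D t.
  by apply: (flex_convex flexD) Dx (flex_stable flexD m Dx) _; rewrite !ltW.
exists m, (t |> m^-1), t; split=> //; first exact: flex_stable.
by apply: lt_trans xt; rewrite act_ltV.
Qed.

Section NormalSubgroups.
Variable N : normalSubgroup K.
Hypothesis N1 : subgroup_set N <> [set 1].

Let NM g h : subgroup_set N g -> subgroup_set N h -> subgroup_set N (g * h).
Proof. exact: subgroupM. Qed.
Let NJ g h : subgroup_set N g -> subgroup_set N (g ^ h).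
Proof. move=> Ng; exact: Defs.normalP. Qed.

(** Conjugate an element that displaces a small interval by one that compresses
    [a, b] into that interval. *)
Lemma normal_displaces a b : D a -> D b ->
  exists2 y, subgroup_set N y & b < a |> y.
Proof.
move=> Da Db; have [ab|ba] := leP a b; last first.
  by exists 1; rewrite ?act1//; apply: subgroup1.
have [m [c [t [Nm Dc Dt ct mt]]]] := displaced_interval (subgroupP N) N1.
have [k [_ ca bt]] := compresses_setT Da Db Dc Dt ab ct.
exists (m ^ k^-1); first exact: NJ.
rewrite actJV invgK -(act_lt A k) actVK; apply: lt_trans bt _.
by rewrite -(act_lt A m^-1) actK mt.
Qed.

(** The element is [k * k^-1 ^ y], which is in [N] as a product of a conjugate of [y^-1]
    and of [y].  The second factor moves only points beyond the image of [r] under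
    [y], so it does not disturb the action of [k] on points whose images stay below
    it. *)
Lemma normal_agree_below k r b : D r -> D b -> fixes_below k r ->
  exists n, [/\ subgroup_set N n, fixes_below n r &
                forall x, x <= b -> x |> n = x |> k].
Proof.
move=> Dr Db kr.
have [y Ny] := normal_displaces Dr (flex_max (flex_stable flexD k Db) Dr).
rewrite gt_max => /andP[bry rry].
exists (k * k^-1 ^ y); split.
- rewrite /conjg mulgA mulgA; apply: NM => //.
  have -> : k * y^-1 * k^-1 = y^-1 ^ k^-1 by rewrite /conjg invgK mulgA.
  exact/NJ/subgroupV.
- move=> x xr; rewrite actM (kr x xr) actJV [x |> _ |> _]fixV ?actVK//.
  by apply: kr; rewrite act_leV (le_trans xr)// ltW.
- move=> x xb; rewrite actM actJV [_ |> y^-1 |> _]fixV ?actVK//.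
  by apply: kr; rewrite act_leV (le_trans _ (ltW bry))// act_le.
Qed.

Lemma normal_agree_above k s a : D s -> D a -> fixes_above k s ->
  exists n, [/\ subgroup_set N n, fixes_above n s &
                forall x, a <= x -> x |> n = x |> k].
Proof.
move=> Ds Da ks.
have [y /subgroupV Ny] := normal_displaces (flex_min (flex_stable flexD k Da) Ds) Ds.
rewrite -act_ltV lt_min => /andP[sya sys].
exists (k * k^-1 ^ y^-1); split.
- rewrite /conjg mulgA mulgA; apply: NM => //.
  have -> : k * y^-1^-1 * k^-1 = y^-1^-1 ^ k^-1 by rewrite /conjg !invgK mulgA.
  exact/NJ/subgroupV.
- move=> x xs; rewrite actM (ks x xs) actJV [x |> _ |> _]fixV ?actVK//.
  by apply: ks; rewrite invgK -act_leV (le_trans _ xs)// ltW.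
- move=> x xa; rewrite actM actJV [_ |> y^-1^-1 |> _]fixV ?actVK//.
  by apply: ks; rewrite invgK -act_leV (le_trans (ltW sya))// act_le.
Qed.

Lemma normal_compresses : compresses D (subgroup_set N).
Proof.
move=> a b c d Da Db Dc Dd ab cd.
have [k [l [[r Dr kr] [s Ds ls] ca bd]]] := two_step_compression Da Db Dc Dd ab cd.
have [k' [Nk' _ kk']] := normal_agree_below Dr Db kr.
have [l' [Nl' _ ll']] := normal_agree_above Ds (flex_stable flexD k Da) ls.
exists (k' * l'); rewrite !actM !kk' ?lexx// !ll' ?lexx ?act_le//; split=> //.
exact: NM.
Qed.

(** The definition of a Thompson pair tests [u] only to the right of [p], and [v] only
    below a certain point, besides the half-lines that they fix. *)
Lemma normal_thompson_pair u v p q : D p -> D q -> thompson_pair A u v p q ->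
  exists u' v', [/\ subgroup_set N u', subgroup_set N v' & thompson_pair A u' v' p q].
Proof.
move=> Dp Dq uv.
have [u' [Nu' u'q u'p]] := normal_agree_above Dq Dp (tp_left uv).
have Db := flex_max (flex_stable flexD u Dp) Dq.
have [v' [Nv' v'p v'b]] := normal_agree_below Dp Db (tp_right uv).
exists u', v'; split=> //; split=> //.
  by rewrite u'p ?lexx// v'b ?(tp_reach uv)// le_max lexx.
by rewrite v'b ?(tp_push uv)// le_max lexx orbT.
Qed.

(** An element that maps [c] to [t > c] does not commute with one that compresses
    [c, t] into its interior. *)
Lemma normal_nonabelian :
  exists g h, [/\ subgroup_set N g, subgroup_set N h & [~ g, h] <> 1].
Proof.
have [m [c [t [Nm Dc Dt ct mt]]]] := displaced_interval (subgroupP N) N1.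
have [n [Nn cn nt]] := normal_compresses Dc Dt Dc Dt (ltW ct) ct.
exists m, n; split=> //.
move/eqP/commgP => /(congr1 (fun g => A g c)).
rewrite !actM => e.
have cm : c |> m = t by rewrite -mt actVK.
have : t < c |> n |> m by rewrite -cm act_lt.
by rewrite -e cm ltNge (ltW nt).
Qed.

End NormalSubgroups.

(** The commutator [[~ m, g]] is [g] times a conjugate of [g^-1] that [m] has carried
    off the interval, so that [h] only sees the factor [g]. *)
Lemma displaced_commutator m c t g h : t |> m^-1 = c ->
  fixes_below g c -> fixes_above h t ->
  [~ [~ m, g], h] = [~ g, h].
Proof.
move=> mt gc ht.
have zh : (g^-1 ^ m) ^ h = g^-1 ^ m.
  apply/conjg_fixP/commgP; apply: (disjoint_commute (A := A)) ht => x xt.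
  rewrite actJV [x |> _ |> _]fixV ?actVK//; apply: gc.
  by rewrite -mt act_le.
by rewrite (commgEr m g) !commgEl conjMg invgM zh -mulgA mulKg.
Qed.

(** Compress the supports of [g] and [h] into an interval that [M] displaces, by an
    element of [S], and apply [displaced_commutator].  The lemma is used with [S] the
    whole group and with [S] a derived subgroup. *)
Lemma normalized_commutator S M :
    is_subgroup S -> is_subgroup M -> (forall m g, M m -> S g -> M (m ^ g)) ->
    M <> [set 1] -> compresses D S ->
  forall g h, S g -> S h -> compactly_supported D g -> compactly_supported D h ->
    M [~ g, h].
Proof.
move=> sS sM MS M1 cS g h Sg Sh [a [b [Da Db ab ga gb]]] [a' [b' [Da' Db' ab' ha hb]]].
pose HM := Subgroup sM; pose HS := Subgroup sS.
have Mcomm (x s : K) : M x -> S s -> M [~ x, s].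
  move=> Mx Ss; rewrite commgEl.
  by apply: (subgroupM (H := HM)); [exact: (subgroupV (H := HM))|exact: MS].
have SJ (x s : K) : S x -> S s -> S (x ^ s).
  move=> Sx Ss; apply: (subgroupM (H := HS)); first exact: (subgroupV (H := HS)).
  exact: (subgroupM (H := HS)).
have [m [c [t [Mm Dc Dt ct mt]]]] := displaced_interval sM M1.
have aa' : Num.min a a' <= Num.max b b' by rewrite ge_min le_max ab.
have [k [Sk ck kt]] := cS _ _ _ _ (flex_min Da Da') (flex_max Db Db') Dc Dt aa' ct.
have below (s : K) a0 : Num.min a a' <= a0 -> fixes_below s a0 -> fixes_below (s ^ k) c.
  move=> le s0 x xc; rewrite actJV s0 ?actVK// (le_trans _ le)// act_leV.
  by rewrite (le_trans xc)// ltW.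
have above (s : K) b0 : b0 <= Num.max b b' -> fixes_above s b0 -> fixes_above (s ^ k) t.
  move=> le s0 x tx; rewrite actJV s0 ?actVK// (le_trans le)// -(act_le A k) actVK.
  by rewrite (le_trans _ tx)// ltW.
have : M [~ g ^ k, h ^ k].
  rewrite -(displaced_commutator mt (below _ a _ ga) (above _ b' _ hb)).
  - by apply: (Mcomm); [apply: (Mcomm) => //; exact: (SJ)|exact: SJ].
  - by rewrite ge_min lexx.
  - by rewrite le_max lexx orbT.
by rewrite -conjRg => /MS /(_ (subgroupV (H := HS) Sk)); rewrite conjgK.
Qed.

End OnD.

End Dynamics.

(** * Homomorphisms, derived series and quotients *)

Section Groups.
Local Open Scope group_scope.
Implicit Types (G Q : groupType).

Lemma generated_sub G (S : set G) (H : set G) :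
  is_subgroup H -> S `<=` H -> generated S `<=` H.
Proof. by move=> sH SH x; apply. Qed.

Lemma mem_generated G (S : set G) : S `<=` generated S.
Proof. by move=> x Sx H [_]; apply. Qed.

Lemma commutator_mem G (H : subgroup G) x y :
  subgroup_set H x -> subgroup_set H y -> subgroup_set (commutator H) [~ x, y].
Proof. by move=> Hx Hy; apply: mem_generated; exists x => //; exists y. Qed.

Section Homomorphisms.
Variables (G Q : groupType) (f : G -> Q).
Hypothesis fM : {morph f : x y / x * y}.

Lemma morph_1 : f 1 = 1.
Proof. by apply: (mulgI (f 1)); rewrite -fM !mulg1. Qed.

Lemma morph_V : {morph f : x / x^-1}.
Proof. by move=> x; apply: (mulgI (f x)); rewrite -fM !mulgV morph_1. Qed.

Lemma morph_F : {morph f : x y / x / y}.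
Proof. by move=> x y; rewrite fM morph_V. Qed.

Lemma morph_R : {morph f : x y / [~ x, y]}.
Proof. by move=> x y; rewrite /commg /conjg !fM !morph_V. Qed.

Lemma preimage_is_subgroup (H : subgroup Q) : is_subgroup (f @^-1` H).
Proof.
split=> [|x y fx fy]; rewrite /preimage /mkset ?morph_1; first exact: subgroup1.
by rewrite morph_F; exact: subgroupF.
Qed.

Lemma image_is_subgroup (H : subgroup G) : is_subgroup (f @` H).
Proof.
split; first by exists 1; rewrite ?morph_1//; exact: subgroup1.
move=> _ _ [x Hx <-] [y Hy <-]; exists (x / y); last by rewrite morph_F.
exact: subgroupF.
Qed.

Lemma derived_hom n x :
  subgroup_set (derived G n) x -> subgroup_set (derived Q n) (f x).
Proof.
elim: n x => [//|n IHn].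
apply: (generated_sub (preimage_is_subgroup (derived Q n.+1))).
move=> _ [x Hx] [y Hy] <-; rewrite /preimage /mkset morph_R.
by apply: commutator_mem; apply: IHn.
Qed.

Lemma derived_surj n : (forall y, exists x, f x = y) ->
  derived Q n `<=` f @` derived G n.
Proof.
move=> fsurj; elim: n => [y _|n IHn]; first by have [x <-] := fsurj y; exists x.
apply: (generated_sub (image_is_subgroup (derived G n.+1))).
move=> _ [_ /IHn[x Hx <-]] [_ /IHn[y Hy <-]] <-.
by exists [~ x, y]; [exact: commutator_mem|rewrite morph_R].
Qed.

End Homomorphisms.

Lemma derived_normal G n : is_normal (derived G n).
Proof.
elim: n => [//|n IHn] x g Hx.
have sJ : is_subgroup [set y : G | subgroup_set (derived G n.+1) (y ^ g)].
  split; first by rewrite /mkset conj1g; exact: subgroup1.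
  by move=> y z; rewrite /mkset => Hy Hz; rewrite conjMg conjVg; apply: subgroupF.
apply: (generated_sub sJ) Hx => _ [y Hy] [z Hz] <-.
by rewrite /mkset conjRg; apply: commutator_mem; apply: IHn.
Qed.

Definition derived_normalSubgroup G n : normalSubgroup G :=
  NormalSubgroup (@derived_normal G n).

Section QuotientMap.
Variables (G : groupType) (N : normalSubgroup G).

Definition quotient_map (x : G) : quotientGroup N := (\pi_(quotientGroup N) x)%qT.

Lemma quotient_mapM : {morph quotient_map : x y / x * y}.
Proof. exact: pi_quotient_mul. Qed.

Lemma quotient_map_surj y : exists x, quotient_map x = y.
Proof. by exists (repr y); rewrite /quotient_map reprK. Qed.

Lemma quotient_map_eq1 x : quotient_map x = 1 <-> subgroup_set N x.
Proof.
rewrite -(morph_1 quotient_mapM); split=> [/eqmodP/coset_relP|Nx]; first by rewrite divg1.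
by apply/eqmodP/coset_relP; rewrite divg1.
Qed.

End QuotientMap.
End Groups.

(** * Derived subgroups of flexible actions *)

Section Flexible.
Variables (R : realType) (K : groupType) (A : order_action R K) (D : set R).
Local Open Scope group_scope.
Hypothesis flexD : flexible A D.
Hypothesis nontrivial : [set: K] <> [set 1].

Lemma flex_derived_nontrivial n : (derived K n : set K) <> [set 1].
Proof.
elim: n => [//|n IHn] d1.
have [g [h [Hg Hh]]] := normal_nonabelian flexD (N := derived_normalSubgroup K n) IHn.
apply; suff : [set 1] [~ g, h] by [].
by rewrite -d1; apply: commutator_mem.
Qed.

Lemma flex_not_solvable : ~ solvable K.
Proof. by move=> [n]; exact: flex_derived_nontrivial. Qed.

Variable k : nat.
Hypothesis derived_compact : forall g, subgroup_set (derived K k) g ->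
  compactly_supported A D g.

(** All elements of the derived subgroup of index [k] are compactly supported, and
    their commutators generate the next one. *)
Lemma flex_derived_sub (N : normalSubgroup K) : subgroup_set N <> [set 1] ->
  derived K k.+1 `<=` (N : set K).
Proof.
move=> N1; apply: generated_sub (subgroupP N) _.
move=> _ [g Hg] [h Hh] <-.
apply: (normalized_commutator flexD (full_is_subgroup K) (subgroupP N)) => //.
- by move=> m x Nm _; apply: Defs.normalP.
- exact: compresses_setT.
- exact: derived_compact.
- exact: derived_compact.
Qed.

Lemma flex_quotient_solvable (N : normalSubgroup K) : subgroup_set N <> [set 1] ->
  solvable_of_degree_le (quotientGroup N) k.+1.
Proof.
move=> N1; rewrite /solvable_of_degree_le eqEsubset; split; last first.
  by move=> _ ->; apply: subgroup1.
move=> y /(derived_surj (@quotient_mapM _ N) (@quotient_map_surj _ N)) [x Hx <-].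
by apply/quotient_map_eq1; apply: flex_derived_sub Hx.
Qed.

Lemma derivedS_sub n : derived K n.+1 `<=` (derived K n : set K).
Proof.
apply: generated_sub (subgroupP _) _ => _ [x Hx] [y Hy] <-.
rewrite commgEl; apply: subgroupM; first exact: subgroupV.
by apply: derived_normal.
Qed.

(** A nontrivial normal subgroup of [H] is normalized by [H], and [H] compresses; so
    it contains [[~ H, H]].  As a nontrivial normal subgroup of the whole group,
    [[~ H, H]] contains [H] by [flex_derived_sub]. *)
Lemma flex_simple : simple (derived K k.+1).
Proof.
set H := derived K k.+1.
have H1 : (H : set K) <> [set 1] := @flex_derived_nontrivial _.
split.
  move=> e; apply: H1; rewrite eqEsubset; split=> [x Hx|_ ->]; last exact: subgroup1.
  have : [set: H] (exist _ x (mem_set Hx)) by [].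
  by rewrite e => /(congr1 val).
move=> M; have [M1|/eqP M1] := eqVneq (M : set H) [set 1]; [by left|right].
pose M' : set K := val @` (M : set H).
have sM' : is_subgroup M'.
  split; first by exists 1 => //; exact: subgroup1.
  move=> _ _ [x Mx <-] [y My <-]; exists (x / y); last by [].
  exact: subgroupF.
have comm g h : subgroup_set H g -> subgroup_set H h -> M' [~ g, h].
  move=> Hg Hh; apply: (normalized_commutator flexD (subgroupP H) sM') => //.
  - move=> _ g' [m Mm <-] Hg'; exists (m ^ (exist _ g' (mem_set Hg'))) => //.
    exact: Defs.normalP.
  - move=> M'1; apply: M1; rewrite eqEsubset; split=> [x Mx|_ ->]; last exact: subgroup1.
    have : M' (val x) by exists x.
    by rewrite M'1 => x1; apply: val_inj; rewrite x1.
  - exact: (normal_compresses flexD (N := derived_normalSubgroup K k.+1)).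
  - by apply: derived_compact; apply: derivedS_sub.
  - by apply: derived_compact; apply: derivedS_sub.
rewrite eqEsubset; split=> // x _.
have HM' : derived K k.+2 `<=` M'.
  by apply: generated_sub sM' _ => _ [g Hg] [h Hh] <-; apply: comm.
have /HM'[y My /val_inj <-//] : subgroup_set (derived K k.+2) (val x).
apply: (flex_derived_sub (N := derived_normalSubgroup K k.+2)).
  exact: flex_derived_nontrivial.
exact: set_mem (valP x).
Qed.

End Flexible.

(** * Orbits of cyclic groups and coherent actions *)

Section CyclicOrbits.
Variables (R : realType) (K : groupType) (A : order_action R K).
Local Open Scope ring_scope.
Local Open Scope group_scope.
Local Notation "x |> g" := (A g%g x) (at level 40, left associativity).
Implicit Types (x y z a b c d e : R) (g h k : K) (D : set R).

Definition cyclic g : subgroup K := generated [set g].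

Lemma cyclic_id g : subgroup_set (cyclic g) g.
Proof. exact: mem_generated. Qed.

Lemma cyclic_fix g k x : subgroup_set (cyclic g) k -> x |> g = x -> x |> k = x.
Proof.
move=> gk gx; have sF : is_subgroup [set l | x |> l = x].
  split=> [|l l']; rewrite /mkset ?act1// => xl xl'.
  by rewrite actM xl fixV.
by apply: (generated_sub sF) gk => _ ->.
Qed.

Lemma cyclic_fixes_below g k r : subgroup_set (cyclic g) k ->
  fixes_below A g r -> fixes_below A k r.
Proof. by move=> gk gr x xr; apply: cyclic_fix gk (gr x xr). Qed.

Lemma cyclic_fixes_above g k s : subgroup_set (cyclic g) k ->
  fixes_above A g s -> fixes_above A k s.
Proof. by move=> gk gs x xs; apply: cyclic_fix gk (gs x xs). Qed.

(** The supremum of an orbit of a cyclic group is invariant under the group. *)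
Lemma bounded_orbit_fixpoint g x b :
  (forall k, subgroup_set (cyclic g) k -> x |> k <= b) ->
  exists z, [/\ x <= z <= b, z |> g = z &
    forall y, y < z -> exists2 k, subgroup_set (cyclic g) k & y < x |> k].
Proof.
move=> xb; pose O := [set x |> k | k in (cyclic g : set K)].
have O0 : O !=set0 by exists (x |> 1), 1 => //; exact: subgroup1.
have Ob : ubound O b by move=> _ [k gk <-]; exact: xb.
have Oz k : subgroup_set (cyclic g) k -> x |> k <= sup O.
  by move=> gk; apply: ub_le_sup; [exists b|exists k].
have shift h : subgroup_set (cyclic g) h -> sup O <= sup O |> h.
  move=> gh; have le k : subgroup_set (cyclic g) k -> x |> k <= sup O |> h.
    move=> gk; rewrite -act_leV -actM; apply: Oz.
    by apply: subgroupM => //; exact: subgroupV.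
  by apply: ge_sup => // _ [k gk <-]; exact: le.
exists (sup O); split; last first.
- by move=> y /(sup_gt O0)[_ [k gk <-] yk]; exists k.
- apply/eqP; rewrite eq_le shift ?andbT; last exact: cyclic_id.
  have := shift g^-1; rewrite -(act_le A g) actVK; apply.
  by apply: subgroupV; exact: cyclic_id.
- by rewrite ge_sup// andbT -[x](act1 A); apply: Oz; exact: subgroup1.
Qed.

(** If the orbit of [d] under [f] stayed below [b], its supremum would be a fixed point
    of [f] to the right of [r0].  So some power brings [d] above [b]; its inverse
    brings [b] below [d]. *)
Lemma push_below D f r0 b d : (forall x y z, D x -> D z -> x <= y <= z -> D y) ->
    (forall x, D x -> r0 < x -> x |> f <> x) -> D b -> D d -> r0 < d ->
  exists2 k, subgroup_set (cyclic f) k & b |> k < d.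
Proof.
move=> Dconv fr Db Dd rd; apply: contrapT => nk.
have db k : subgroup_set (cyclic f) k -> d |> k <= b.
  move=> fk; rewrite leNgt -act_ltV; apply/negP => kb; apply: nk.
  by exists k^-1 => //; exact: subgroupV.
have [z [/andP[dz zb] zf _]] := bounded_orbit_fixpoint db.
apply: fr zf; last exact: lt_le_trans dz.
by apply: Dconv Dd Db _; rewrite dz.
Qed.

Lemma push_above D g e a c : (forall x y z, D x -> D z -> x <= y <= z -> D y) ->
    (forall x, D x -> x < e -> x |> g <> x) -> D a -> D c -> c < e ->
  exists2 k, subgroup_set (cyclic g) k & c < a |> k.
Proof.
move=> Dconv ge Da Dc ce; apply: contrapT => nk.
have ac k : subgroup_set (cyclic g) k -> a |> k <= c.
  by move=> gk; rewrite leNgt; apply/negP => kc; apply: nk; exists k.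
have [z [/andP[az zc] zg _]] := bounded_orbit_fixpoint ac.
apply: ge zg; last exact: le_lt_trans ce.
by apply: Dconv Da Dc _; rewrite az.
Qed.

Lemma conj_fixes_below g h r : fixes_below A g r -> fixes_below A (g ^ h) (r |> h).
Proof. by move=> gr x xr; rewrite actJV gr ?actVK// act_leV. Qed.

Lemma conj_fixes_above g h s : fixes_above A g s -> fixes_above A (g ^ h) (s |> h).
Proof. by move=> gs x sx; rewrite actJV gs ?actVK// -(act_le A h) actVK. Qed.

Lemma conj_fix g h x : x |> g ^ h = x -> x |> h^-1 |> g = x |> h^-1.
Proof. by rewrite actJV => /(congr1 (A h^-1)); rewrite actK. Qed.

(** The pushing elements are conjugates of powers of [f] and [g], so minimality only
    enters through two points: [r0], whose translates must go down arbitrarily far,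
    and [e], whose translates must meet every interval. *)
Lemma flexible_intro D f r r0 g s e :
    (forall x y z, D x -> D z -> x <= y <= z -> D y) ->
    (forall h x, D x -> D (x |> h)) -> (forall h x, x |> h <> x -> D x) ->
    D r -> fixes_below A f r -> (forall x, D x -> r0 < x -> x |> f <> x) ->
    (forall d, D d -> exists h, r0 |> h < d) ->
    D s -> fixes_above A g s -> e |> g = e -> (forall x, D x -> x < e -> x |> g <> x) ->
    (forall c d, D c -> D d -> c < d -> exists h, c < e |> h < d) ->
  flexible A D.
Proof.
move=> Dconv Dact Dmov Dr fr fr0 minr Ds gs ge ge0 mine; split=> //.
  move=> b d Db Dd; have [h rhd] := minr d Dd.
  have [|k fk kd] := @push_below D (f ^ h) (r0 |> h) b d Dconv _ Db Dd rhd.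
    move=> x Dx rx /conj_fix; apply: fr0; first exact: Dact.
    by rewrite -(act_lt A h) actVK.
  exists k; split=> //; exists (r |> h); first exact: Dact.
  exact/(cyclic_fixes_below fk)/conj_fixes_below.
move=> c d Dc Dd cd; have [h ehcd] := mine c d Dc Dd cd.
exists (e |> h); split=> // a Da ae; case/andP: ehcd => ceh _.
have [|k gk ck] := @push_above D (g ^ h) (e |> h) a c Dconv _ Da Dc ceh.
  move=> x Dx xe /conj_fix; apply: ge0; first exact: Dact.
  by rewrite act_ltV.
exists k; split=> //; last by apply: cyclic_fix gk _; rewrite actJ ge.
exists (s |> h); first exact: Dact.
exact/(cyclic_fixes_above gk)/conj_fixes_above.
Qed.

(** After conjugating [f], its moving zone begins to the left of [s0].  A power [u] of
    [g] brings the end of the support of the conjugate into that zone, from where a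
    power of the conjugate, named [v^-1] in the proof, carries points beyond the
    support of [g]. *)
Lemma thompson_pair_intro f r r0 g s s0 :
    fixes_below A f r -> (forall x, r0 < x -> x |> f <> x) ->
    fixes_above A g s -> (forall x, x < s0 -> x |> g <> x) ->
    (exists h, r0 |> h < s0) ->
  exists u v p q, thompson_pair A u v p q.
Proof.
move=> fr fr0 gs gs0 [h rhs].
have convT x y z : [set: R] x -> [set: R] z -> x <= y <= z -> [set: R] y by [].
have [|u gu pu] := @push_above setT g s0 (r |> h) (r0 |> h) convT _ I I rhs.
  by move=> x _; exact: gs0.
pose q := Num.max s (r0 |> h + 1)%R.
have q_gt : r0 |> h < q by rewrite lt_max ltrDl ltr01 orbT.
(* both [q] and the image of [p] have to be carried beyond [q], so push the smaller one *)
have y_gt : r0 |> h < Num.min (r |> h |> u) q by rewrite lt_min pu.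
have [|v fv vy] := @push_below setT (f ^ h) (r0 |> h) q _ convT _ I I y_gt.
  move=> x _ rx /conj_fix; apply: fr0.
  by rewrite -(act_lt A h) actVK.
rewrite lt_min in vy; case/andP: vy => v1 v2.
exists u, v^-1, (r |> h), q; split.
- by apply: (cyclic_fixes_below (subgroupV fv)); exact: conj_fixes_below.
- move=> x qx; apply: (cyclic_fixes_above gu gs); apply: le_trans qx.
  by rewrite le_max lexx.
- by rewrite -act_leV invgK ltW.
- by rewrite -act_ltV invgK.
Qed.

End CyclicOrbits.

Section CoherentActions.
Variables (R : realType) (G : groupType) (B : subgroup (homeo R)).
Variable f : G -> B.
Hypothesis fM : {morph f : x y / (x * y)%g}.
Hypothesis f_bij : bijective f.
Hypothesis cohB : coherent B.
Local Open Scope ring_scope.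
Local Open Scope group_scope.

Definition homeo_act (g : G) (x : R) : R := homeo_fun (val (f g)) x.

Lemma homeo_act1 x : homeo_act 1 x = x.
Proof. by rewrite /homeo_act (morph_1 fM). Qed.

Lemma homeo_actM g h x : homeo_act (g * h) x = homeo_act h (homeo_act g x).
Proof. by rewrite /homeo_act fM. Qed.

Lemma homeo_act_le g : {mono homeo_act g : x y / x <= y}.
Proof. by move=> x y; rewrite /homeo_act (homeo_le (val (f g))). Qed.

Lemma homeo_act_faithful g : (forall x, homeo_act g x = x) -> g = 1.
Proof.
move=> g1; apply: (bij_inj f_bij); rewrite (morph_1 fM).
by apply/val_inj/homeo_inj => x; exact: g1.
Qed.

Definition homeo_action : order_action R G :=
  OrderAction homeo_act1 homeo_actM homeo_act_le homeo_act_faithful.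

Lemma homeo_act_lift (g : homeo R) : subgroup_set B g ->
  exists g', forall x, homeo_action g' x = g x.
Proof.
move=> Bg; case: f_bij => f' f'K fK'.
by exists (f' (exist _ g (mem_set Bg))) => x; rewrite /= /homeo_act fK'.
Qed.

Lemma coherent_orbit x c d : c < d -> exists h, c < homeo_action h x < d.
Proof.
move=> cd; case: cohB => minB _ _ _.
have cd_open : open `]c, d[%classic by exact: interval_open.
have [|y [ycd [h Bh hxy]]] := minB x _ _ cd_open.
  by exists ((c + d) / 2)%R; rewrite /= in_itv /=; apply/andP; split; lra.
have [h' h'E] := homeo_act_lift Bh; exists h'; rewrite h'E hxy.
by rewrite /= in_itv in ycd.
Qed.

Lemma coherent_below : exists g r r0, fixes_below homeo_action g r /\
  forall x, r0 < x -> homeo_action g x <> x.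
Proof.
case: cohB => _ _ [g [Bg [r gr] [r0 gr0]]] _.
(* germs are given on open half-lines, [fixes_below] uses closed ones, hence [r - 1] *)
have [g' g'E] := homeo_act_lift Bg; exists g', (r - 1)%R, r0; split=> x.
  by move=> xr; rewrite g'E gr//; lra.
by rewrite g'E; exact: gr0.
Qed.

Lemma coherent_above : exists g s s0, fixes_above homeo_action g s /\
  forall x, x < s0 -> homeo_action g x <> x.
Proof.
case: cohB => _ _ _ [g [Bg [s gs] [s0 gs0]]].
have [g' g'E] := homeo_act_lift Bg; exists g', (s + 1)%R, s0; split=> x.
  by move=> xs; rewrite g'E gs//; lra.
by rewrite g'E; exact: gs0.
Qed.

Lemma coherent_thompson_pair : exists u v p q, thompson_pair homeo_action u v p q.
Proof.
have [g [r [r0 [gr gr0]]]] := coherent_below.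
have [h [s [s0 [hs hs0]]]] := coherent_above.
apply: thompson_pair_intro gr gr0 hs hs0 _.
have [|k /andP[_ ?]] := @coherent_orbit r0 (s0 - 1)%R s0; first lra.
by exists k.
Qed.

(** The barrier for [flexible_intro] is the supremum of an orbit of [h] that starts in
    the zone without fixed points.  It is the first fixed point of [h]: a fixed point
    below it would be passed by that orbit. *)
Lemma coherent_flexible : flexible homeo_action setT.
Proof.
have [g [r [r0 [gr gr0]]]] := coherent_below.
have [h [s [s0 [hs hs0]]]] := coherent_above.
pose x0 := (s0 - 1)%R.
have x0b k : subgroup_set (cyclic h) k -> homeo_action k x0 <= Num.max x0 s.
  move=> hk; rewrite -[leRHS](cyclic_fixes_above hk hs) ?act_le; last first.
    by rewrite le_max lexx orbT.
  by rewrite le_max lexx.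
have [e [_ he ek]] := bounded_orbit_fixpoint x0b.
apply: (@flexible_intro _ _ _ setT g r r0 h s e) => //.
- by move=> x _; exact: gr0.
- move=> d _; have [|k /andP[_ ?]] := @coherent_orbit r0 (d - 1)%R d; first lra.
  by exists k.
- move=> x _ /ek[k hk xk] hx.
  have xfix : homeo_action k x = x := cyclic_fix hk hx.
  apply: (hs0 x) => //; apply: (@lt_trans _ _ x0); last by rewrite /x0; lra.
  by rewrite -(act_lt homeo_action k) xfix.
- by move=> c d _ _ /(coherent_orbit e).
Qed.

Lemma germ_derived (Q : groupType) (pi : B -> Q) n g :
  {morph pi : x y / x * y} -> solvable_of_degree_le Q n ->
  subgroup_set (derived G n) g -> pi (f g) = 1.
Proof.
move=> piM Qn gn; suff : [set 1] (pi (f g)) by [].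
rewrite -Qn; apply: (derived_hom (f := pi \o f)) gn => x y /=.
by rewrite fM piM.
Qed.

Lemma derived_le n m : (n <= m)%N -> derived G m `<=` (derived G n : set G).
Proof.
move=> /subnK <-; elim: (m - n)%N => //= k IHk x /derivedS_sub.
exact: IHk.
Qed.

(** The derived subgroups of sufficiently large index die in both groups of germs. *)
Lemma coherent_derived_compact : exists k, forall g, subgroup_set (derived G k) g ->
  compactly_supported homeo_action setT g.
Proof.
case: cohB => _ [[n1 s1] [n2 s2]] _ _; exists (maxn n1 n2) => g gk.
have g1 : subgroup_set (derived G n1) g by apply: derived_le gk; exact: leq_maxl.
have g2 : subgroup_set (derived G n2) g by apply: derived_le gk; exact: leq_maxr.
have /quotient_map_eq1[r gr] := germ_derived (@quotient_mapM _ _) s1 g1.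
have /quotient_map_eq1[s gs] := germ_derived (@quotient_mapM _ _) s2 g2.
exists (Num.min (s - 1)%R (r + 1)%R), (r + 1)%R; split=> //.
- by rewrite ge_min lexx orbT.
- by move=> x; rewrite le_min => /andP[xs _]; apply: gs; lra.
- by move=> x rx; apply: gr; lra.
Qed.

End CoherentActions.

(** * Homeomorphisms of the unit interval acting on the line *)

Section UnitIntervalAction.
Variable R : realType.
Local Notation I := (@unit_interval R).
Local Open Scope ring_scope.
Implicit Types (f g : homeo I) (x y : R) (h : R -> R).

(** The homeomorphism extended by the identity, which lets Thompson's group act on
    the whole line. *)
Definition unit_act f x : R :=
  if 0 <= x <= 1 then set_val (f (Defs.point x)) else x.

Lemma unit_actE f (x : I) : unit_act f (set_val x) = set_val (f x).
Proof.
rewrite /unit_act unitP; congr (set_val (homeo_fun f _)).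
by apply: val_inj; rewrite -set_valE pointK// unitP.
Qed.

Lemma unit_act_out f x : ~~ (0 <= x <= 1) -> unit_act f x = x.
Proof. by rewrite /unit_act => /negbTE ->. Qed.

Lemma unit_act_in f x : 0 <= x <= 1 -> 0 <= unit_act f x <= 1.
Proof. by rewrite /unit_act => ->; exact: unitP. Qed.

Lemma unit_act_le f : {mono unit_act f : x y / x <= y}.
Proof.
apply: le_mono => x y xy.
have [x01|x01] := boolP (0 <= x <= 1); have [y01|y01] := boolP (0 <= y <= 1).
- by rewrite /unit_act x01 y01 unit_homeo_lt !pointK.
- have /andP[_ fx1] := unit_act_in f x01; rewrite (unit_act_out f y01).
  by apply: le_lt_trans fx1 _; move: x01 y01 xy; lra.
- have /andP[fy0 _] := unit_act_in f y01; rewrite (unit_act_out f x01).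
  by apply: lt_le_trans fy0; move: x01 y01 xy; lra.
- by rewrite !unit_act_out.
Qed.

Lemma unit_act1 x : unit_act 1%g x = x.
Proof. by rewrite /unit_act; case: ifP => // x01; rewrite homeo1E pointK. Qed.

Lemma unit_actM f g x : unit_act (f * g)%g x = unit_act g (unit_act f x).
Proof.
have [x01|x01] := boolP (0 <= x <= 1); last by rewrite !unit_act_out.
rewrite -(pointK x01) !unit_actE homeoME//.
Qed.

Lemma unit_act_faithful f : (forall x, unit_act f x = x) -> f = 1%g.
Proof.
move=> f1; apply: homeo_inj => x; apply: val_inj.
by rewrite -!set_valE -unit_actE f1.
Qed.

Lemma restricted_continuous h (hp : forall x : I, 0 <= h (set_val x) <= 1) :
  continuous h -> continuous (fun x : I => Defs.point (h (set_val x)) : I).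
Proof.
move=> ch; apply: continuous_comp_initial.
have -> : set_val \o (fun x : I => Defs.point (h (set_val x)) : I) = h \o set_val.
  by apply/funext => x /=; rewrite pointK.
move=> x; apply: continuous_comp; last exact: ch.
exact: initial_continuous.
Qed.

(** The preimage of an open interval under an order isomorphism is an open interval. *)
Lemma order_iso_continuous h h' :
  {mono h : x y / x <= y} -> cancel h' h -> continuous h.
Proof.
move=> /leW_mono hlt h'K x; apply/cvgrPdist_lt => e e0.
have xI : x \in `]h' (h x - e), h' (h x + e)[.
  by rewrite in_itv /= -(hlt _ x) -(hlt x) !h'K; apply/andP; split; lra.
apply: filterS (near_in_itvoo xI) => y.
rewrite in_itv /= -(hlt _ y) -(hlt y) !h'K => /andP[? ?].
by rewrite ltr_distlC; apply/andP; split; lra.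
Qed.

Lemma unit_homeo_extend h h' :
    {mono h : x y / x <= y} -> cancel h h' -> cancel h' h -> h 0 = 0 -> h 1 = 1 ->
  exists f, forall x, 0 <= x <= 1 -> unit_act f x = h x.
Proof.
move=> hle hK h'K h0 h1.
have ch : continuous h := order_iso_continuous hle h'K.
have h'le : {mono h' : x y / x <= y} by move=> x y; rewrite -hle !h'K.
have ch' : continuous h' := order_iso_continuous h'le hK.
have hp (x : I) : 0 <= h (set_val x) <= 1.
  by move: (unitP x); rewrite -(hle 0) -(hle _ 1) h0 h1.
have h'p (x : I) : 0 <= h' (set_val x) <= 1.
  by rewrite -(hle 0) -(hle _ 1) h0 h1 h'K unitP.
have fH : is_homeo (fun x : I => Defs.point (h (set_val x)) : I).
  split; first exact: restricted_continuous.
    by move=> x y; rewrite /Order.le /= !pointK// hle.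
  exists (fun x : I => Defs.point (h' (set_val x)) : I); split.
  - by move=> x; apply: val_inj; rewrite -!set_valE !pointK ?hK// unitP.
  - by move=> x; apply: val_inj; rewrite -!set_valE !pointK ?h'K// unitP.
  - exact: restricted_continuous.
exists (Homeo fH) => x x01; rewrite -{1}(pointK x01) unit_actE /= pointK ?pointK//.
by rewrite -[X in h X](pointK x01).
Qed.

(** The slopes are [2], [1] and [1/2], with breakpoints at [1/4] and [1/2].  The map is
    concave, so it is a minimum of affine maps, and its inverse is a maximum. *)
Definition x0_map x : R := Num.min (Num.min (2 * x) (x + 1/4)) (x/2 + 1/2).
Definition x0_inv x : R := Num.max (Num.max (x/2) (x - 1/4)) (2 * x - 1).

(** Nested minima and maxima are split from the inside, so that the comparisons left
    in the context are linear. *)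
Ltac minmax_step a b :=
  lazymatch constr:((a, b)) with
  | context [Order.min _ _] => fail
  | context [Order.max _ _] => fail
  | _ => case: (leP a b) => ?
  end.
Ltac minmax := rewrite /x0_map /x0_inv; repeat match goal with
  | |- context [Order.min ?a ?b] => minmax_step a b
  | |- context [Order.max ?a ?b] => minmax_step a b
  end; lra.

Lemma x0_mapK : cancel x0_map x0_inv. Proof. move=> x; minmax. Qed.
Lemma x0_invK : cancel x0_inv x0_map. Proof. move=> x; minmax. Qed.

Lemma x0_map_le : {mono x0_map : x y / x <= y}.
Proof. by apply: le_mono => x y xy; minmax. Qed.

Lemma x0_map0 : x0_map 0 = 0.
Proof. minmax. Qed.

Lemma x0_map1 : x0_map 1 = 1.
Proof. minmax. Qed.

Lemma x0_map_gt0 x : (0 < x0_map x) = (0 < x).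
Proof. by rewrite -{1}x0_map0 (leW_mono x0_map_le). Qed.

Lemma x0_inv_gt0 x : (0 < x0_inv x) = (0 < x).
Proof. by rewrite -x0_map_gt0 x0_invK. Qed.

(** The copy of [x0_map] on the right half of the unit interval. *)
Definition x1_map x : R := if x <= 1/2 then x else (1 + x0_map (2 * x - 1)) / 2.
Definition x1_inv x : R := if x <= 1/2 then x else (1 + x0_inv (2 * x - 1)) / 2.

Lemma x1_map_low x : x <= 1/2 -> x1_map x = x.
Proof. by rewrite /x1_map => ->. Qed.

Lemma x1_map_high x : 0 <= x -> x1_map ((1 + x) / 2) = (1 + x0_map x) / 2.
Proof.
rewrite le_eqVlt => /orP[/eqP<-|x_gt0]; first by rewrite x0_map0 x1_map_low; lra.
rewrite /x1_map ifF; last by apply/negbTE; lra.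
by congr ((1 + x0_map _) / 2); lra.
Qed.

Lemma x1_mapK : cancel x1_map x1_inv.
Proof.
move=> x; have [x2|x2] := leP x (1/2); first by rewrite x1_map_low// /x1_inv x2.
have xE : x = (1 + (2 * x - 1)) / 2 by lra.
have := x0_map_gt0 (2 * x - 1); rewrite subr_gt0 => pos.
rewrite {1}xE x1_map_high; last lra.
rewrite /x1_inv ifF; last by apply/negbTE; move: pos; lra.
have -> : 2 * ((1 + x0_map (2 * x - 1)) / 2) - 1 = x0_map (2 * x - 1) by lra.
by rewrite x0_mapK -xE.
Qed.

Lemma x1_invK : cancel x1_inv x1_map.
Proof.
move=> x; rewrite /x1_inv; have [x2|x2] := leP x (1/2); first exact: x1_map_low.
have pos : 0 < x0_inv (2 * x - 1) by rewrite x0_inv_gt0; lra.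
by rewrite x1_map_high ?x0_invK; lra.
Qed.

Lemma x1_map_le : {mono x1_map : x y / x <= y}.
Proof.
apply: le_mono => x y xy; have [y2|y2] := leP y (1/2).
  by rewrite !x1_map_low//; lra.
have yE : y = (1 + (2 * y - 1)) / 2 by lra.
have [x2|x2] := leP x (1/2).
  have pos : 0 < x0_map (2 * y - 1) by rewrite x0_map_gt0; lra.
  by rewrite (x1_map_low x2) yE x1_map_high; lra.
have xE : x = (1 + (2 * x - 1)) / 2 by lra.
have lt_map : x0_map (2 * x - 1) < x0_map (2 * y - 1).
  by rewrite (leW_mono x0_map_le); lra.
by rewrite xE yE !x1_map_high; lra.
Qed.

Lemma x0_exists : exists f, forall x, 0 <= x <= 1 -> unit_act f x = x0_map x.
Proof.
exact: unit_homeo_extend x0_map_le x0_mapK x0_invK x0_map0 x0_map1.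
Qed.

Lemma x1_exists : exists f, forall x, 0 <= x <= 1 -> unit_act f x = x1_map x.
Proof.
apply: unit_homeo_extend x1_map_le x1_mapK x1_invK _ _.
  by apply: x1_map_low; lra.
have e : 1 = (1 + 1) / 2 :> R by lra.
by rewrite [X in x1_map X]e x1_map_high ?x0_map1; lra.
Qed.

End UnitIntervalAction.

(** * The generators of Thompson's group *)

Section ThompsonGenerators.
Variable R : realType.
Local Open Scope ring_scope.
Implicit Types (x y s : R).

Lemma x0_map_low x : x <= 1/4 -> x0_map x = 2 * x.
Proof. by move=> ?; rewrite /x0_map !min_l//; lra. Qed.

Lemma x0_map_mid x : 1/4 <= x <= 1/2 -> x0_map x = x + 1/4.
Proof. by move=> ?; rewrite /x0_map min_l ?min_r//; lra. Qed.

Lemma x0_map_high x : 1/2 <= x -> x0_map x = (1 + x) / 2.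
Proof. by move=> ?; rewrite /x0_map [X in Num.min X _]min_r ?min_r//; lra. Qed.

Definition piecewise (f : R -> R) : Prop :=
  exists s : seq R, (forall p, p \in s -> dyadic p) /\
  forall a b : R, 0 <= a -> a < b -> b <= 1 -> (forall p, p \in s -> ~~ (a < p < b)) ->
    exists (k : int) (c : R), forall x, a <= x <= b -> f x = 2%:R ^ k * x + c.

Lemma is_thompson_intro (f : homeo (@unit_interval R)) h :
  (forall x, 0 <= x <= 1 -> unit_act f x = h x) -> piecewise h -> is_thompson f.
Proof.
move=> fh [s [ds hs]]; exists s; split=> // a b a0 ab b1 nab.
have [k [c hE]] := hs a b a0 ab b1 nab; exists k, c => x xab.
by rewrite -unit_actE fh ?unitP// hE.
Qed.

Lemma x0_map_piecewise : piecewise (@x0_map R).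
Proof.
exists [:: 1/4; 1/2]; split=> [p|a b a0 ab b1 nab].
  rewrite !inE => /orP[]/eqP->; first by exists 1, 2; rewrite -natrX.
  by exists 1, 1; rewrite expr1.
have n1 : ~~ (a < 1/4 < b) by apply: nab; rewrite !inE eqxx.
have n2 : ~~ (a < 1/2 < b) by apply: nab; rewrite !inE eqxx orbT.
have [b4|b4] := leP b (1/4).
  by exists 1, 0 => x xab; rewrite expr1z x0_map_low; lra.
have [b2|b2] := leP b (1/2).
  by exists 0, (1/4) => x xab; rewrite expr0z x0_map_mid; lra.
by exists (-1), (1/2) => x xab; rewrite -invr_expz expr1z x0_map_high; lra.
Qed.

Lemma x1_map_piecewise : piecewise (@x1_map R).
Proof.
have x1E x : 1/2 <= x -> x1_map x = (1 + x0_map (2 * x - 1)) / 2.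
  by move=> xh; rewrite -x1_map_high; [congr x1_map|]; lra.
exists [:: 1/2; 5/8; 3/4]; split=> [p|a b a0 ab b1 nab].
  rewrite !inE => /or3P[]/eqP->; first by exists 1, 1; rewrite expr1.
    by exists 5, 3; rewrite -natrX.
  by exists 3, 2; rewrite -natrX.
have n1 : ~~ (a < 1/2 < b) by apply: nab; rewrite !inE eqxx.
have n2 : ~~ (a < 5/8 < b) by apply: nab; rewrite !inE eqxx orbT.
have n3 : ~~ (a < 3/4 < b) by apply: nab; rewrite !inE eqxx !orbT.
have [b2|b2] := leP b (1/2).
  by exists 0, 0 => x xab; rewrite expr0z x1_map_low; lra.
have [b5|b5] := leP b (5/8).
  by exists 1, (-(1/2)) => x xab; rewrite expr1z x1E ?x0_map_low; lra.
have [b3|b3] := leP b (3/4).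
  by exists 0, (1/8) => x xab; rewrite expr0z x1E ?x0_map_mid; lra.
by exists (-1), (1/2) => x xab; rewrite -invr_expz expr1z x1E ?x0_map_high; lra.
Qed.

Let F : groupType := thompsonF R.

Definition thompson_act (f : F) : R -> R := unit_act (val f).

Lemma thompson_act1 x : thompson_act 1%g x = x.
Proof. by rewrite /thompson_act gmulf1 unit_act1. Qed.

Lemma thompson_actM (f g : F) x :
  thompson_act (f * g)%g x = thompson_act g (thompson_act f x).
Proof. by rewrite /thompson_act gmulfM unit_actM. Qed.

Lemma thompson_act_faithful (f : F) : (forall x, thompson_act f x = x) -> f = 1%g.
Proof. by move=> /unit_act_faithful f1; apply: val_inj; rewrite gmulf1. Qed.

Definition thompson_action : order_action R F :=
  OrderAction thompson_act1 thompson_actM (fun f => unit_act_le (val f)) thompson_act_faithful.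
Arguments thompson_action : simpl never.

Lemma thompson_x0_exists : exists f : F, forall x, 0 <= x <= 1 -> thompson_action f x = x0_map x.
Proof.
have [f fE] := x0_exists R.
have fF : f \in subgroup_set (thompsonF R).
  by apply: mem_set; apply: is_thompson_intro fE x0_map_piecewise.
by exists (exist _ f fF).
Qed.

Lemma thompson_x1_exists : exists f : F, forall x, 0 <= x <= 1 -> thompson_action f x = x1_map x.
Proof.
have [f fE] := x1_exists R.
have fF : f \in subgroup_set (thompsonF R).
  by apply: mem_set; apply: is_thompson_intro fE x1_map_piecewise.
by exists (exist _ f fF).
Qed.

Definition thompson_x0 : F := projT1 (cid thompson_x0_exists).
Definition thompson_x1 : F := projT1 (cid thompson_x1_exists).

Lemma thompson_x0E x : 0 <= x <= 1 -> thompson_action thompson_x0 x = x0_map x.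
Proof. by rewrite /thompson_x0; case: cid => f /= fE; exact: fE. Qed.

Lemma thompson_x1E x : 0 <= x <= 1 -> thompson_action thompson_x1 x = x1_map x.
Proof. by rewrite /thompson_x1; case: cid => f /= fE; exact: fE. Qed.

Lemma thompson_act_out (f : F) x : ~~ (0 <= x <= 1) -> thompson_action f x = x.
Proof. exact: unit_act_out. Qed.

Lemma thompson_act_in (f : F) x : 0 <= x <= 1 -> 0 <= thompson_action f x <= 1.
Proof. exact: unit_act_in. Qed.

Local Notation u := (thompson_x0 * thompson_x1^-1)%g.
Local Notation v := thompson_x1.

(** Between [1/2] and [1] the first generator is [x |-> (1 + x) / 2], and so is the
    second one between [3/4] and [1]; hence their quotient is trivial there. *)
Lemma thompson_standard_pair : thompson_pair thompson_action u v (1/2) (3/4).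
Proof.
have x1h x : 3/4 <= x <= 1 -> thompson_action v x = (1 + x) / 2.
  move=> xh; have -> : x = (1 + (2 * x - 1)) / 2 by lra.
  by rewrite thompson_x1E ?x1_map_high ?x0_map_high; lra.
have x0h x : 1/2 <= x <= 1 -> thompson_action thompson_x0 x = (1 + x) / 2.
  by move=> xh; rewrite thompson_x0E ?x0_map_high; lra.
split.
- move=> x xh; have [x0|x0] := leP 0 x; last by rewrite thompson_act_out; lra.
  by rewrite thompson_x1E ?x1_map_low; lra.
- move=> x xh; have [x1|x1] := leP x 1; last by rewrite thompson_act_out; lra.
  by rewrite actM x0h -?x1h ?actK; lra.
- by rewrite -actM mulgVK x0h; lra.
- by rewrite x1h; lra.
Qed.

Definition thompson_X : nat -> F := thompson_gen u v.

Lemma thompson_X0 : thompson_X 0 = thompson_x0.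
Proof. by rewrite /thompson_X /= mulgVK. Qed.

Lemma thompson_XS i : thompson_X i.+1 = (thompson_x1 ^ (thompson_x0 ^+ i))%g.
Proof. by rewrite /thompson_X /= mulgVK. Qed.

(** The affine map from the unit interval onto its last part, of length [2^-i]. *)
Definition tail i s : R := 1 - (1/2) ^+ i * (1 - s).

Lemma tail_in i s : 0 <= s <= 1 -> 0 <= tail i s <= 1.
Proof.
move=> s01; have p0 : (0 : R) <= (1/2) ^+ i by apply: exprn_ge0; lra.
have p1 : (1/2) ^+ i <= (1 : R) by apply: exprn_ile1; lra.
by rewrite /tail; nra.
Qed.

Lemma tailS i s : tail i.+1 s = (1 + tail i s) / 2.
Proof. by rewrite /tail exprS; lra. Qed.

Lemma thompson_x0_tail i s : 0 <= s <= 1 ->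
  thompson_action thompson_x0 (tail i.+1 s) = tail i.+2 s.
Proof.
move=> s01; have := tail_in i s01; have := tail_in i.+1 s01.
rewrite (tailS i.+1) => h1 h0; rewrite thompson_x0E// x0_map_high//.
by rewrite tailS; lra.
Qed.

(** The letter [X_i] is the copy of the first generator on the last part of length
    [2^-i]: conjugating by the first generator shifts these parts by one. *)
Lemma thompson_X_tail i s : 0 <= s <= 1 ->
  thompson_action (thompson_X i) (tail i s) = tail i (x0_map s).
Proof.
move=> s01; have x0s : 0 <= x0_map s <= 1 by rewrite -thompson_x0E ?thompson_act_in.
case: i => [|i].
  by rewrite thompson_X0 /tail expr0 !mul1r !subKr thompson_x0E.
elim: i => [|i IHi].
  rewrite thompson_XS expg0 conjg1 !tailS /tail expr0 !mul1r !subKr.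
  by rewrite thompson_x1E ?x1_map_high; lra.
have XSS : (thompson_X i.+2 = thompson_X i.+1 ^ thompson_x0)%g.
  by rewrite !thompson_XS expgSr conjgM.
by rewrite XSS -thompson_x0_tail// actJ IHi thompson_x0_tail.
Qed.

Lemma thompson_X_fix i x : x <= tail i 0 -> thompson_action (thompson_X i) x = x.
Proof.
case: i => [|i] xt.
  have := xt; rewrite /tail expr0 mul1r subr0 subrr le_eqVlt => /orP[/eqP->|x0].
    by rewrite thompson_X0 thompson_x0E ?x0_map_low; lra.
  by rewrite thompson_act_out; lra.
apply: (thompson_pair_gen_fix thompson_standard_pair); apply: le_trans xt _.
rewrite mulgVK; elim: i => [|i IHi]; first by rewrite expg0 act1 /tail; lra.
rewrite -thompson_x0_tail ?lexx ?ler01//.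
by rewrite expgSr actM act_le.
Qed.

End ThompsonGenerators.

(** * Dyadic subdivisions and positive elements *)

(** Dyadic subdivisions of an interval: a node cuts it at its midpoint. *)
Inductive tree : Type := Leaf | Node of tree & tree.

Fixpoint weight (t : tree) : nat :=
  if t is Node t1 t2 then (weight t1 + weight t2).+1 else 1.

Section Subdivisions.
Variable R : realType.
Local Open Scope ring_scope.
Implicit Types (a l x : R) (f g : R -> R) (p q : R * R) (L M : seq (R * R)) (t : tree).

(** Intervals are given by their left end and their length. *)
Fixpoint leaves t a l : seq (R * R) :=
  if t is Node t1 t2 then leaves t1 a (l / 2) ++ leaves t2 (a + l / 2) (l / 2)
  else [:: (a, l)].

Lemma leaves_gt0 t a l : (0 < size (leaves t a l))%N.
Proof. by elim: t a l => //= t1 IH1 t2 _ a l; rewrite size_cat addn_gt0 IH1. Qed.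

Definition carries f p q : Prop :=
  forall s, 0 <= s <= 1 -> f (p.1 + s * p.2) = q.1 + s * q.2.

(** Homeomorphisms are compared through the lists of intervals that they carry
    affinely, in order, onto each other: two of them that send one covering list to
    the same list coincide ([sends_unique]). *)
Fixpoint sends f L M : Prop :=
  match L, M with
  | p :: L', q :: M' => carries f p q /\ sends f L' M'
  | [::], [::] => True
  | _, _ => False
  end.

Lemma sends_size f L M : sends f L M -> size L = size M.
Proof. by elim: L M => [|p L IHL] [|q M] //= [_ /IHL ->]. Qed.

Lemma sends_cat f L1 M1 L2 M2 :
  sends f L1 M1 -> sends f L2 M2 -> sends f (L1 ++ L2) (M1 ++ M2).
Proof. by elim: L1 M1 => [|p L IHL] [|q M] //= [pq LM] LM2; split=> //; apply: IHL. Qed.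

Lemma sends_comp f g L M N : sends f L M -> sends g M N -> sends (g \o f) L N.
Proof.
elim: L M N => [|p L IHL] [|q M] [|r N] //= [pq LM] [qr MN].
by split; [move=> s s01; rewrite /= pq// qr|exact: IHL MN].
Qed.

Lemma sends_ext f g L M : f =1 g -> sends f L M -> sends g L M.
Proof.
move=> fg; elim: L M => [|p L IHL] [|q M] //= [pq LM].
by split; [move=> s s01; rewrite -fg pq|exact: IHL].
Qed.

Lemma sends_nth f L M j : sends f L M -> (j < size L)%N ->
  carries f (nth (0, 0) L j) (nth (0, 0) M j).
Proof.
by elim: L M j => [|p L IHL] [|q M] [|j] //= [pq LM] //; exact: IHL.
Qed.

Lemma carries_sends_leaves f t a l a' l' :
  carries f (a, l) (a', l') -> sends f (leaves t a l) (leaves t a' l').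
Proof.
elim: t a l a' l' => [|t1 IH1 t2 IH2] a l a' l' fal /=; first by split.
apply: sends_cat; [apply: IH1|apply: IH2] => s s01 /=.
  have -> : a + s * (l / 2) = a + s / 2 * l by lra.
  by rewrite fal /=; lra.
have -> : a + l / 2 + s * (l / 2) = a + (1 + s) / 2 * l by lra.
by rewrite fal /=; lra.
Qed.

Definition covered L x : Prop :=
  exists j s, [/\ (j < size L)%N, 0 <= s <= 1 &
    x = (nth (0, 0) L j).1 + s * (nth (0, 0) L j).2].

Lemma covered_cat L M x : covered L x \/ covered M x -> covered (L ++ M) x.
Proof.
move=> [[j [s [jL s01 ->]]]|[j [s [jM s01 ->]]]].
  by exists j, s; rewrite nth_cat jL size_cat ltn_addr.
exists (size L + j)%N, s; rewrite nth_cat size_cat ltn_add2l.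
by rewrite [(size L + j < size L)%N]ltnNge leq_addr addKn.
Qed.

Lemma leaves_covered t a l x : a <= x <= a + l -> covered (leaves t a l) x.
Proof.
elim: t a l => [|t1 IH1 t2 IH2] a l xal /=.
  have [l0|l0] := eqVneq l 0; first by exists 0%N, 0; split=> //=; lra.
  have lp : 0 < l by rewrite lt_neqAle eq_sym l0; lra.
  exists 0%N, ((x - a) / l); split=> //=; last by rewrite divfK//; lra.
  by rewrite divr_ge0 ?ler_pdivrMr//; lra.
apply: covered_cat; have [xm|xm] := leP x (a + l / 2); [left|right].
  by apply: IH1; lra.
by apply: IH2; lra.
Qed.

Lemma sends_unique f g L M x : sends f L M -> sends g L M -> covered L x -> f x = g x.
Proof.
move=> fLM gLM [j [s [jL s01 ->]]].
by rewrite (sends_nth fLM jL s01) (sends_nth gLM jL s01).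
Qed.

Local Notation h i := ((1/2 : R) ^+ i).

(** The trees subdivide the successive intervals cut at the points [1 - 2^-i]; the last
    tree subdivides what remains up to [1], hence the two different lengths. *)
Fixpoint forest (i : nat) (ts : seq tree) : seq (R * R) :=
  match ts with
  | [::] => [::]
  | [:: t] => leaves t (1 - h i) (h i)
  | t :: ts' => leaves t (1 - h i) (h i.+1) ++ forest i.+1 ts'
  end.

Lemma forest_cons i t t' ts :
  forest i (t :: t' :: ts) = leaves t (1 - h i) (h i.+1) ++ forest i.+1 (t' :: ts).
Proof. by []. Qed.

Definition vine i n := forest i (nseq n Leaf).

Lemma vineS i n : (0 < n)%N -> vine i n.+1 = (1 - h i, h i.+1) :: vine i.+1 n.
Proof. by case: n. Qed.

Lemma vine_nth i n j : (j < n)%N -> (nth (0, 0) (vine i n) j).1 = 1 - h (i + j)%N.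
Proof.
elim: n i j => [//|n IHn] i j; case: n IHn => [_|n IHn jn]; first by case: j => //=; rewrite addn0.
rewrite vineS//; case: j jn => [|j] jn; first by rewrite addn0.
by rewrite [nth _ _ _]/= IHn// addSnnS.
Qed.

Lemma halfS i : h i = 2 * h i.+1.
Proof. by rewrite exprS; lra. Qed.

Lemma half_ge0 i : 0 <= h i.
Proof. by apply: exprn_ge0; lra. Qed.

Lemma forest_last_node i t1 t2 : forest i [:: Node t1 t2] = forest i [:: t1; t2].
Proof.
rewrite /= halfS; congr (leaves _ _ _ ++ leaves _ _ _); rewrite ?exprS; lra.
Qed.

Section PositiveElements.
Local Notation X := (@thompson_X R).
Local Notation act := (@thompson_action R).

(** On the last part of length [2^-(i+1)] the letter [X_i] is [x |-> (1 + x) / 2], which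
    moves each interval cut at the points [1 - 2^-j] to the next one. *)
Lemma thompson_X_shift i x : 1 - h i.+1 <= x <= 1 -> act (X i) x = (1 + x) / 2.
Proof.
move=> xi; have hp : 0 < h i by apply: exprn_gt0; lra.
have hS := halfS i.
pose s := 1 - (1 - x) / h i.
have xE : x = tail i s by rewrite /tail /s opprB addrCA subrr addr0 mulrC divfK ?gt_eqF//; lra.
have : 1/2 <= s <= 1.
  rewrite /s; have : (1 - x) / h i <= 1/2 by rewrite ler_pdivrMr//; lra.
  have : 0 <= (1 - x) / h i by rewrite divr_ge0//; lra.
  by lra.
move=> s1; rewrite xE thompson_X_tail; last lra.
by rewrite x0_map_high ?/tail; lra.
Qed.

Lemma thompson_X_carries_shift i a l : 1 - h i.+1 <= a -> 0 <= l -> a + l <= 1 ->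
  carries (act (X i)) (a, l) ((1 + a) / 2, l / 2).
Proof.
move=> ia l0 al s s01; rewrite thompson_X_shift /=; first by lra.
by nra.
Qed.

Lemma half_le i j : (i <= j)%N -> h j <= h i.
Proof. by move=> ij; apply: ler_wiXn2l => //; lra. Qed.

Lemma thompson_X_forest_shift i j ts : (i < j)%N ->
  sends (act (X i)) (forest j ts) (forest j.+1 ts).
Proof.
elim: ts j => [//|t [|t' ts] IHts] j ij.
  apply: carries_sends_leaves => s s01.
  have [-> ->] : 1 - h j.+1 = (1 + (1 - h j)) / 2 /\ h j.+1 = h j / 2.
    by rewrite (halfS j); lra.
  apply: thompson_X_carries_shift => //; rewrite ?half_ge0//.
    by have := half_le ij; lra.
  by lra.
rewrite !forest_cons; apply: sends_cat; last by apply: IHts; rewrite ltnW.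
apply: carries_sends_leaves => s s01.
have [-> ->] : 1 - h j.+1 = (1 + (1 - h j)) / 2 /\ h j.+2 = h j.+1 / 2.
  by rewrite (halfS j) (halfS j.+1); lra.
apply: thompson_X_carries_shift => //; rewrite ?half_ge0//.
  by have := half_le ij; lra.
by rewrite (halfS j); have := half_ge0 j.+1; lra.
Qed.

(** The letter [X_i] stretches the two halves of the interval of index [i] to the
    intervals of index [i] and [i + 1], so it deletes the root of the tree that hangs
    there. *)
Lemma thompson_X_split i t1 t2 t ts :
  sends (act (X i)) (forest i [:: Node t1 t2, t & ts]) (forest i [:: t1, t2, t & ts]).
Proof.
rewrite forest_cons [leaves _ _ _]/= -catA 2!forest_cons.
have x0E s : 0 <= s <= 1 -> act (X i) (1 - h i + s * h i) = 1 - h i + x0_map s * h i.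
  move=> s01; have := thompson_X_tail i s01; rewrite /tail.
  have -> : 1 - h i * (1 - s) = 1 - h i + s * h i by lra.
  by move=> ->; lra.
have h1 := halfS i; have h2 := halfS i.+1.
apply: sends_cat; last apply: sends_cat; last exact: thompson_X_forest_shift.
- apply: carries_sends_leaves => s s01; rewrite [(_, _).1]/= [(_, _).2]/=.
  have -> : 1 - h i + s * (h i.+1 / 2) = 1 - h i + s / 4 * h i by rewrite h1; lra.
  by rewrite x0E ?x0_map_low ?h1 /=; lra.
- apply: carries_sends_leaves => s s01; rewrite [(_, _).1]/= [(_, _).2]/=.
  have -> : 1 - h i + h i.+1 / 2 + s * (h i.+1 / 2) = 1 - h i + (1 + s) / 4 * h i.
    by rewrite h1; lra.
  by rewrite x0E ?x0_map_mid ?h1 ?h2 /=; lra.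
Qed.

Lemma positive_fix i w x : all (leq i) w -> x <= 1 - h i -> act (eval_word X w) x = x.
Proof.
move=> + xi; elim: w => [|j w IHw]; first by rewrite act1.
rewrite [all _ _]/= [eval_word _ _]/= => /andP[ij wi]; rewrite actM thompson_X_fix ?IHw//.
by rewrite /tail; have := half_le ij; lra.
Qed.

(** Delete the carets one by one, from left to right.  The restriction on the letters of
    [w] ensures that it does not disturb the intervals that are already done. *)
Lemma forest_to_vine i ts : (0 < size ts)%N -> exists w, all (leq i) w /\
  sends (act (eval_word X w)) (forest i ts) (vine i (size (forest i ts))).
Proof.
have [n] := ubnP (sumn [seq weight t | t <- ts]).
elim: n ts i => // n IHn [|[|t1 t2] [|t ts]] i wn ts0 //.
- by exists [::]; split=> //; split=> // s s01; rewrite act1.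
- have [|w [wi ws]] := IHn (t :: ts) i.+1 _ isT; first by move: wn; rewrite /= add1n ltnS.
  exists w; split; first by apply: sub_all wi => j; exact: ltnW.
  rewrite forest_cons [_ ++ _]/= [size _]/= vineS.
    split=> // s s01; rewrite (positive_fix wi)//.
    by rewrite /= (halfS i); have := half_ge0 i.+1; nra.
  by case: ts {wn ws ts0} => [|t' ts] //=; rewrite ?size_cat ?addn_gt0 ?leaves_gt0.
- rewrite forest_last_node; apply: IHn => //.
  by move: wn; rewrite /= !addn0 ltnS.
- have [|w [wi ws]] := IHn [:: t1, t2, t & ts] i _ isT.
    by move: wn => /=; lia.
  have split := thompson_X_split i t1 t2 t ts.
  exists (i :: w); split; first by rewrite /= leqnn.
  rewrite (sends_size split); apply: sends_ext (sends_comp split ws) => x.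
  by rewrite [eval_word X (i :: w)]/= actM.
Qed.

End PositiveElements.
End Subdivisions.

(** * Every element of Thompson's group is a fraction *)

Section DyadicCells.
Variable R : realType.
Local Open Scope ring_scope.
Implicit Types (N P D d : nat) (ds : seq nat).

(** Integers replace the dyadic numbers of denominator [2^N]: [P] is a position and an
    entry [d] stands for the length [2^d], both in units of [2^-N]. *)
Fixpoint cells N P ds : seq (R * R) :=
  if ds is d :: ds' then
    (P%:R / 2 ^+ N, (2 ^ d)%:R / 2 ^+ N) :: cells N (P + 2 ^ d)%N ds'
  else [::].

(** Alignment singles out the dyadic subdivisions among the partitions into intervals
    whose lengths are powers of [2] ([aligned_tree]). *)
Fixpoint aligned P ds : bool :=
  if ds is d :: ds' then (2 ^ d %| P)%N && aligned (P + 2 ^ d)%N ds' else true.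

Definition total ds : nat := sumn [seq (2 ^ d)%N | d <- ds].

Lemma total_cat ds1 ds2 : total (ds1 ++ ds2) = (total ds1 + total ds2)%N.
Proof. by rewrite /total map_cat sumn_cat. Qed.

Lemma total1 d : total [:: d] = (2 ^ d)%N.
Proof. by rewrite /total /= addn0. Qed.

Lemma cells_cat N P ds1 ds2 :
  cells N P (ds1 ++ ds2) = cells N P ds1 ++ cells N (P + total ds1)%N ds2.
Proof.
elim: ds1 P => [|d ds1 IH] P /=; first by rewrite addn0.
by rewrite IH addnA.
Qed.

Lemma aligned_cat P ds1 ds2 :
  aligned P (ds1 ++ ds2) = aligned P ds1 && aligned (P + total ds1)%N ds2.
Proof.
elim: ds1 P => [|d ds1 IH] P /=; first by rewrite addn0.
by rewrite IH addnA andbA.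
Qed.

Lemma total_gt0 ds : (0 < total ds)%N -> exists d ds', ds = d :: ds'.
Proof. by case: ds => // d ds' _; exists d, ds'. Qed.

(** By alignment, no interval straddles the midpoint of a dyadic interval that contains
    more than one of them.  A recursive bisection thus cuts the list into the leaves
    of a tree. *)
Lemma aligned_tree_prefix D P d ds :
    (2 ^ D %| P)%N -> aligned P (d :: ds) -> (2 ^ D <= total (d :: ds))%N -> (d <= D)%N ->
  exists t ds1 ds2, [/\ d :: ds = ds1 ++ ds2, total ds1 = (2 ^ D)%N &
    forall N, cells N P ds1 = leaves t (P%:R / 2 ^+ N) ((2 ^ D)%:R / 2 ^+ N)].
Proof.
elim: D P d ds => [|D IHD] P d ds DP al tot.
  rewrite leqn0 => /eqP d0; exists Leaf, [:: d], ds; rewrite total1 d0; split=> //.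
rewrite leq_eqVlt => /orP[/eqP dD|]; last rewrite ltnS => dD.
  by exists Leaf, [:: d], ds; rewrite total1 dD; split.
have DDP : (2 ^ D %| P)%N by apply: dvdn_trans DP; rewrite dvdn_exp2l.
have tot1 : (2 ^ D <= total (d :: ds))%N.
  by apply: leq_trans tot; rewrite leq_exp2l.
have [t1 [ds1 [ds2 [dsE tot1E cells1]]]] := IHD _ _ _ DDP al tot1 dD.
have tot2 : (2 ^ D <= total ds2)%N.
  by move: tot; rewrite dsE total_cat tot1E expnS; lia.
have [|d' [ds' ds2E]] := @total_gt0 ds2; first by apply: leq_trans tot2; rewrite expn_gt0.
move: al; rewrite dsE aligned_cat tot1E => /andP[_ al2].
have DP2 : (2 ^ D %| P + 2 ^ D)%N by rewrite dvdn_addr.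
(* the second half begins at an odd multiple of [2^D], where no longer interval may begin *)
have d'D : (d' <= D)%N.
  rewrite leqNgt; apply/negP => Dd'.
  move: al2; rewrite ds2E /= => /andP[d'P _].
  have : (2 ^ D.+1 %| P + 2 ^ D)%N by apply: dvdn_trans d'P; rewrite dvdn_exp2l.
  by rewrite dvdn_addr// dvdn_Pexp2l// ltnn.
rewrite ds2E in al2 tot2.
have [t2 [ds3 [ds4 [ds2E' tot3 cells2]]]] := IHD _ _ _ DP2 al2 tot2 d'D.
exists (Node t1 t2), (ds1 ++ ds3), ds4; split.
- by rewrite ds2E ds2E' catA.
- by rewrite total_cat tot1E tot3 expnS mul2n addnn.
move=> N; rewrite cells_cat tot1E cells1 cells2 /=.
have -> : (2 ^ D.+1)%:R / 2 ^+ N / 2 = (2 ^ D)%:R / 2 ^+ N :> R.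
  by rewrite expnS natrM; lra.
by rewrite natrD mulrDl.
Qed.

Lemma aligned_tree N ds : aligned 0 ds -> total ds = (2 ^ N)%N ->
  exists t, cells N 0 ds = leaves t 0 1.
Proof.
move=> al tot; have [|d [ds' dsE]] := @total_gt0 ds; first by rewrite tot expn_gt0.
rewrite dsE in al tot *.
have dN : (d <= N)%N.
  by rewrite -(@leq_exp2l 2)// -tot /total /= leq_addr.
have [|t [ds1 [ds2 [e tot1 cellsE]]]] := aligned_tree_prefix (dvdn0 (2 ^ N)) al _ dN.
  by rewrite tot.
have /eqP : total ds2 = 0%N by move: tot; rewrite e total_cat tot1; lia.
case: ds2 e => [|d2 ds2] e; last by rewrite /total /= addn_eq0 expn_eq0.
move=> _; exists t; rewrite e cats0 cellsE mul0r natrX divff//.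
by rewrite expf_neq0// pnatr_eq0.
Qed.

Lemma aligned_nseq n : forall P, aligned P (nseq n 0%N).
Proof. by elim: n => //= n IHn P; rewrite dvd1n IHn. Qed.

Lemma total_nseq n : total (nseq n 0%N) = n.
Proof. by rewrite /total; elim: n => //= n IHn; rewrite [sumn _]IHn. Qed.

Lemma uniform_tree k : exists t, cells k 0 (nseq (2 ^ k) 0%N) = leaves t 0 1.
Proof. by apply: aligned_tree; [exact: aligned_nseq|exact: total_nseq]. Qed.

Lemma cells_size N P ds : size (cells N P ds) = size ds.
Proof. by elim: ds P => //= d ds IHds P; rewrite IHds. Qed.

Lemma uniform_nth N P n j : (j < n)%N ->
  (nth (0, 0) (cells N P (nseq n 0%N)) j).1 = (P + j)%:R / 2 ^+ N.
Proof.
elim: n P j => //= n IHn P [|j] jn /=; first by rewrite addn0.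
by rewrite IHn// addnAC addn1 addnS.
Qed.

End DyadicCells.

Section ThompsonGrid.
Variable R : realType.
Local Open Scope ring_scope.
Local Notation F := (thompsonF R : groupType).
Local Notation act := (@thompson_action R).
Local Notation X := (@thompson_X R).
Implicit Types (f g : F) (i j k a e : nat) (p : R).

Lemma thompson_act0 f : act f 0 = 0.
Proof.
have le0 g : 0 <= act g 0.
  by have := @thompson_act_in R g 0; rewrite lexx ler01 => /(_ isT)/andP[].
apply/eqP; rewrite eq_le le0 andbT -(act_le act (f^-1)%g) actK.
exact: le0.
Qed.

Lemma thompson_act_1 f : act f 1 = 1.
Proof.
have le1 g : act g 1 <= 1.
  by have := @thompson_act_in R g 1; rewrite lexx ler01 => /(_ isT)/andP[].
apply/eqP; rewrite eq_le le1 -(act_le act (f^-1)%g) actK.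
exact: le1.
Qed.

Definition on_grid k p : Prop := exists m : int, p = m%:~R / 2 ^+ k.

(** The cells of dyadic grids are the intervals that occur as leaves of trees, hence
    the form required of the image. *)
Definition grid_image f k j : Prop := exists a e,
  carries (act f) (j%:R / 2 ^+ k, 1 / 2 ^+ k) (a%:R / 2 ^+ e, 1 / 2 ^+ e).

Lemma exp2_neq0 k : (2 : R) ^+ k != 0.
Proof. by rewrite expf_neq0// pnatr_eq0. Qed.

Lemma exp2_gt0 k : 0 < (2 : R) ^+ k.
Proof. by rewrite exprn_gt0// ltr0n. Qed.

Lemma on_grid_le k l p : (k <= l)%N -> on_grid k p -> on_grid l p.
Proof.
move=> kl [m ->]; exists (m * 2 ^+ (l - k)).
have -> : (2 : R) ^+ l = 2 ^+ (l - k) * 2 ^+ k by rewrite -exprD subnK.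
by rewrite rmorphM rmorphXn /= [m%:~R * _ ^+ _]mulrC -mulf_div divff ?exp2_neq0// mul1r.
Qed.

Lemma common_grid (s : seq R) : (forall p, p \in s -> dyadic p) ->
  exists k, forall p, p \in s -> on_grid k p.
Proof.
elim: s => [|q s IHs] ds; first by exists 0%N.
have [|k sk] := IHs; first by move=> p ps; apply: ds; rewrite inE ps orbT.
have [m [l ->]] := ds q (mem_head _ _); exists (maxn k l) => p.
rewrite inE => /orP[/eqP->|/sk]; last by apply: on_grid_le; exact: leq_maxl.
by apply: (@on_grid_le l); [exact: leq_maxr|exists m].
Qed.

(** On the given piece the map is [x |-> 2^n x + c] with [c] dyadic.  When [k] exceeds
    [n] plus the exponent of the denominator of [c], the constant [c] is a multiple of
    the length [2^(n - k)] of the images of the cells. *)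
Lemma piece_grid_image f (s : seq R) k0 i :
    (forall p, p \in s -> dyadic p) -> thompson_on s (val f) ->
    (forall p, p \in s -> on_grid k0 p) -> (i < 2 ^ k0)%N ->
  exists K, forall k j, (K <= k)%N -> i%:R / 2 ^+ k0 <= j%:R / 2 ^+ k :> R ->
    j.+1%:R / 2 ^+ k <= i.+1%:R / 2 ^+ k0 :> R -> grid_image f k j.
Proof.
move=> ds fs gs ik0; have p0 := exp2_gt0 k0.
set a := i%:R / 2 ^+ k0 : R; set b := i.+1%:R / 2 ^+ k0 : R.
have a0 : 0 <= a by rewrite divr_ge0// ltW.
have ab : a < b by rewrite ltr_pM2r ?invr_gt0// ltr_nat.
have b1 : b <= 1 by rewrite ler_pdivrMr// mul1r -natrX ler_nat.
have nab p : p \in s -> ~~ (a < p < b).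
  move=> /gs[m ->]; rewrite !ltr_pM2r ?invr_gt0//.
  by rewrite -[i%:R]/(i%:~R) -[i.+1%:R]/(i.+1%:~R) !ltr_int; lia.
have [n [c fE']] := fs a b a0 ab b1 nab.
have fE x : a <= x <= b -> act f x = 2 ^ n * x + c.
  move=> xab; have x01 : 0 <= x <= 1 by lra.
  by rewrite -(pointK x01) /= /thompson_act unit_actE fE' ?pointK.
have [z [l cE]] : dyadic c.
  have a01 : 0 <= a <= 1 by lra.
  have -> : c = act f a + - (2 ^ n * a) by rewrite fE; lra.
  apply: dyadicD; last apply: dyadicN; last apply: dyadicMz.
    rewrite -(pointK a01) /= /thompson_act unit_actE.
    apply: (thompson_dyadic ds fs _).1; rewrite pointK//.
    by exists i, k0.
  by exists i, k0.
exists (l + `|n|)%N => k j kK aj jb.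
have [e [nE le]] : exists e : nat, n = k%:Z - e%:Z /\ (l <= e)%N.
  by exists `|k%:Z - n|%N; lia.
have pk := exp2_gt0 k; have pe := exp2_gt0 e.
have nk : (2 : R) ^ n = 2 ^+ k / 2 ^+ e by rewrite nE expfzDr ?pnatr_eq0// exprnN.
(* the numerator, over [2^e], of the image of the left end of the cell *)
pose w : int := j%:Z + z * 2 ^+ (e - l).
have wE : w%:~R / 2 ^+ e = j%:R / 2 ^+ e + c :> R.
  rewrite rmorphD mulrDl; congr (_ + _).
  have -> : (2 : R) ^+ e = 2 ^+ (e - l) * 2 ^+ l by rewrite -exprD subnK.
  by rewrite rmorphM rmorphXn /= [z%:~R * _ ^+ _]mulrC -mulf_div divff ?exp2_neq0// mul1r.
have fj x : a <= (j%:R + x) / 2 ^+ k <= b ->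
    act f ((j%:R + x) / 2 ^+ k) = w%:~R / 2 ^+ e + x / 2 ^+ e.
  move=> xab; rewrite fE// nk wE; field.
  by rewrite !exp2_neq0.
have range x : 0 <= x <= 1 -> a <= (j%:R + x) / 2 ^+ k <= b.
  move=> x01; apply/andP; split.
    by apply: le_trans aj _; rewrite ler_pM2r ?invr_gt0//; lra.
  by apply: le_trans jb; rewrite ler_pM2r ?invr_gt0// -natr1; lra.
have w0 : 0 <= w.
  have := range 0; rewrite lexx ler01 addr0 => /(_ isT) r0.
  have := fj 0; rewrite mul0r !addr0 => /(_ r0) fw.
  pose y : R := j%:R / 2 ^+ k.
  have r01 : 0 <= y <= 1 by move: r0; rewrite -/y; lra.
  have /andP[+ _] := thompson_act_in f r01.
  by rewrite fw pmulr_lge0 ?invr_gt0// ler0z.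
exists `|w|%N, e => x x01.
change (act f (j%:R / 2 ^+ k + x * (1 / 2 ^+ k)) = `|w|%N%:R / 2 ^+ e + x * (1 / 2 ^+ e)).
rewrite natr_absz ger0_norm//.
have -> : j%:R / 2 ^+ k + x * (1 / 2 ^+ k) = (j%:R + x) / 2 ^+ k by lra.
by rewrite fj ?range//; lra.
Qed.

Lemma uniform_threshold (n : nat) (P : nat -> nat -> Prop) :
  (forall i, (i < n)%N -> exists K, forall k, (K <= k)%N -> P i k) ->
  exists K, forall i k, (i < n)%N -> (K <= k)%N -> P i k.
Proof.
elim: n => [|n IHn] H; first by exists 0%N.
have [|K1 HK1] := IHn; first by move=> i /ltnW; exact: H.
have [K2 HK2] := H n (ltnSn n).
exists (maxn K1 K2) => i k; rewrite ltnS leq_eqVlt geq_max => /orP[/eqP->|ni] /andP[? ?].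
  exact: HK2.
exact: HK1.
Qed.

Lemma thompson_grid_image f : exists k, forall j, (j < 2 ^ k)%N -> grid_image f k j.
Proof.
have [s [ds fs]] : is_thompson (val f) by exact: (set_mem (valP f)).
have [k0 gs] := common_grid ds.
have [|K HK] := @uniform_threshold (2 ^ k0) (fun i k => forall j,
    i%:R / 2 ^+ k0 <= j%:R / 2 ^+ k :> R -> j.+1%:R / 2 ^+ k <= i.+1%:R / 2 ^+ k0 :> R ->
    grid_image f k j).
  move=> i ik0; have [K HK] := piece_grid_image ds fs gs ik0.
  by exists K => k kK j; exact: HK.
exists (maxn K k0) => j jk; set k := maxn K k0 in jk *.
have k0k : (k0 <= k)%N by exact: leq_maxr.
have kE : (2 ^ k = 2 ^ (k - k0) * 2 ^ k0)%N by rewrite -expnD subnK.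
have kER : (2 : R) ^+ k = 2 ^+ (k - k0) * 2 ^+ k0 by rewrite -exprD subnK.
pose m := (2 ^ (k - k0))%N; have m0 : (0 < m)%N by rewrite expn_gt0.
have le_div (x y : nat) : (x * m <= y)%N -> x%:R / 2 ^+ k0 <= y%:R / 2 ^+ k :> R.
  move=> xy; rewrite ler_pdivrMr ?exp2_gt0// mulrAC ler_pdivlMr ?exp2_gt0//.
  by rewrite kER mulrA ler_pM2r ?exp2_gt0// -natrX -natrM ler_nat.
have ge_div (x y : nat) : (x <= y * m)%N -> x%:R / 2 ^+ k <= y%:R / 2 ^+ k0 :> R.
  move=> xy; rewrite ler_pdivrMr ?exp2_gt0// mulrAC ler_pdivlMr ?exp2_gt0//.
  by rewrite kER mulrA ler_pM2r ?exp2_gt0// -natrX -natrM ler_nat.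
apply: (HK (j %/ m)%N k); first by rewrite ltn_divLR// mulnC -kE.
- exact: leq_maxl.
- by apply: le_div; exact: leq_trunc_div.
- by apply: ge_div; rewrite ltn_ceil.
Qed.

(** The images of the cells of a fine grid form an aligned list. *)
Lemma thompson_trees f : exists t1 t2,
  sends (act f) (leaves t1 0 1) (leaves t2 0 1).
Proof.
have [k fk] := thompson_grid_image f.
have /choice[a /choice[e ae]] : forall j, exists a e, (j < 2 ^ k)%N ->
    carries (act f) (j%:R / 2 ^+ k, 1 / 2 ^+ k) (a%:R / 2 ^+ e, 1 / 2 ^+ e).
  move=> j; have [jk|jk] := ltnP j (2 ^ k); last by exists 0%N, 0%N.
  by have [a [e ae]] := fk j jk; exists a, e.
(* a common denominator [2^N] for all the images *)
have [N HN] : exists N, forall j, (j < 2 ^ k)%N -> (e j <= N)%N.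
  exists (\max_(j < 2 ^ k) e j) => j jk.
  exact: (@leq_bigmax _ (fun j : 'I_(2 ^ k) => e j) (Ordinal jk)).
pose ds n := [seq (N - e j)%N | j <- iota 0 n].
have dsS n : ds n.+1 = ds n ++ [:: (N - e n)%N].
  by rewrite /ds -addn1 iotaD map_cat.
have nS n : nseq n.+1 0%N = nseq n 0%N ++ [:: 0%N] by rewrite -addn1 nseqD.
have ds_grid n : (n <= 2 ^ k)%N -> [/\ aligned 0 (ds n),
    (total (ds n))%:R = act f (n%:R / 2 ^+ k) * 2 ^+ N &
    sends (act f) (cells R k 0 (nseq n 0%N)) (cells R N 0 (ds n))].
  elim: n => [_|n IHn nk]; first by rewrite mul0r thompson_act0 mul0r.
  have [al tot sn] := IHn (ltnW nk).
  have aen := ae n nk; have eN := HN n nk.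
  have NE : (2 : R) ^+ N = 2 ^+ (N - e n) * 2 ^+ e n by rewrite -exprD subnK.
  have dE : (2 ^ (N - e n))%:R / 2 ^+ N = 1 / 2 ^+ e n :> R.
    rewrite NE natrX.
    by field; rewrite !exp2_neq0.
  have totE : total (ds n) = (a n * 2 ^ (N - e n))%N.
    apply/eqP; rewrite -(eqr_nat R) tot.
    have := aen 0; rewrite /= lexx ler01 mul0r addr0 => ->//.
    rewrite mul0r addr0 natrM natrX NE.
    by apply/eqP; field; rewrite !exp2_neq0.
  have aE : (total (ds n))%:R / 2 ^+ N = (a n)%:R / 2 ^+ e n :> R.
    by rewrite totE natrM -mulrA dE mulrA mulr1.
  rewrite dsS nS !cells_cat aligned_cat total_cat total_nseq total1 !add0n; split.
  - by rewrite al /= andbT totE dvdn_mull.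
  - have := aen 1; rewrite /= lexx ler01 => /(_ isT); rewrite !mul1r.
    have -> : n%:R / 2 ^+ k + (2 ^+ k)^-1 = n.+1%:R / 2 ^+ k :> R by rewrite -natr1; lra.
    move=> ->; rewrite natrD -(divfK (exp2_neq0 N) (total _)%:R) aE.
    rewrite -[X in _ + X](divfK (exp2_neq0 N)) dE; lra.
  - apply: sends_cat => //; split=> // s s01; rewrite [(_, _).1]/=.
    by have := aen s s01; rewrite /= aE dE.
have [al tot sk] := ds_grid _ (leqnn _).
have [t1 t1E] := uniform_tree R k.
have [|t2 t2E] := @aligned_tree R N (ds (2 ^ k)%N) al.
  apply/eqP; rewrite -(eqr_nat R) tot natrX divff ?exp2_neq0// thompson_act_1.
  by rewrite mul1r natrX.
by exists t1, t2; rewrite -t1E -t2E.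
Qed.

Lemma forest_one t : forest R 0 [:: t] = leaves t 0 1.
Proof. by rewrite /= expr0 subrr. Qed.

(** With trees [t1] and [t2] such that [f] sends [t1] to [t2], positive elements send [t1]
    and [t2] to the same standard subdivision. *)
Lemma thompson_fractions : fractions X.
Proof.
move=> f; have [t1 [t2 ft]] := thompson_trees f.
have [p [_ p_vine]] := @forest_to_vine R 0 [:: t1] isT.
have [q [_ q_vine]] := @forest_to_vine R 0 [:: t2] isT.
rewrite !forest_one -(sends_size ft) in p_vine q_vine.
exists p, q; suff <- : (f * eval_word X q = eval_word X p)%g by rewrite mulgK.
apply: (act_ext (A := act)) => x.
have [x01|x01] := boolP (0 <= x <= 1); last by rewrite !thompson_act_out.
rewrite actM; apply: (sends_unique (sends_comp ft q_vine) p_vine).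
by apply: leaves_covered; lra.
Qed.

(** A positive element sends the given point, which is a cut of a uniform subdivision,
    to a point [1 - 2^-j]; those are the translates of [1/2] by powers of the first
    generator. *)
Lemma thompson_dyadic_transitive k j : (0 < j < 2 ^ k)%N ->
  exists g, act g (1/2) = j%:R / 2 ^+ k.
Proof.
move=> /andP[j0 jk]; have [t tE] := uniform_tree R k.
have [w [_ ws]] := @forest_to_vine R 0 [:: t] isT.
rewrite forest_one -tE cells_size size_nseq in ws.
have := sends_nth ws (j := j); rewrite cells_size size_nseq => /(_ jk 0).
rewrite lexx ler01 !mul0r !addr0 uniform_nth// vine_nth// !add0n => /(_ isT) wj.
have half : 1 - (1/2) ^+ j = act (thompson_x0 R ^+ j.-1)%g (1/2).
  case: j j0 {jk wj} => // j _; rewrite -[RHS]/(act (_ ^+ j)%g _).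
  elim: j => [|j IHj]; first by rewrite expg0 act1 expr1; lra.
  rewrite expgSr actM -IHj; have := @thompson_x0_tail R j 0.
  by rewrite /tail lexx ler01 subr0 !mulr1 => ->.
exists (thompson_x0 R ^+ j.-1 * (eval_word X w)^-1)%g.
by rewrite actM -half -wj actK.
Qed.

End ThompsonGrid.

(** * Copies of Thompson's group *)

Section ThompsonEmbedding.
Variables (R : realType).
Local Open Scope ring_scope.
Local Notation F := (thompsonF R : groupType).
Local Notation act := (@thompson_action R).
Local Notation x0 := (thompson_x0 R).
Local Notation x1 := (thompson_x1 R).
Local Notation u := (x0 * x1^-1)%g.

Theorem thompson_embeds (K : groupType) (A : order_action R K) (a b : K) (p q : R) :
  thompson_pair A a b p q ->
  exists phi : F -> K, [/\ {morph phi : x y / (x * y)%g}, injective phi &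
    forall (H : subgroup K) f, subgroup_set H a -> subgroup_set H b -> subgroup_set H (phi f)].
Proof.
move=> ab; have std := thompson_standard_pair R.
have [phi [phiM phiI phiE]] := fraction_embedding
  (thompson_pair_shifting std) (thompson_pair_shifting ab)
  (thompson_pair_separating std) (thompson_pair_separating ab) (@thompson_fractions R).
exists phi; split=> // H f Ha Hb.
have HX i : subgroup_set H (thompson_gen a b i).
  have Hab := subgroupM Ha Hb.
  have Hpow j : subgroup_set H ((a * b) ^+ j)%g.
    elim: j => [|j IHj]; first by rewrite expg0; exact: subgroup1.
    by rewrite expgS; exact: subgroupM.
  case: i => [//|i]; apply: subgroupM; first exact/subgroupV.
  exact: subgroupM.
have Hw w : subgroup_set H (eval_word (thompson_gen a b) w).
  by elim: w => [|i w IHw]; [exact: subgroup1|exact: subgroupM].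
by have [w [w' ->]] := phiE f; exact: subgroupF.
Qed.

(** Every letter is a product of the two generators and their inverses. *)
Lemma thompson_generated (H : subgroup F) :
  subgroup_set H x0 -> subgroup_set H x1 -> forall f, subgroup_set H f.
Proof.
move=> H0 H1 f; have HX i : subgroup_set H (thompson_X R i).
  case: i => [|i]; first by rewrite thompson_X0.
  rewrite thompson_XS; have Hpow : subgroup_set H (x0 ^+ i)%g.
    elim: i => [|i IHi]; first by rewrite expg0; exact: subgroup1.
    by rewrite expgS; exact: subgroupM.
  by apply: subgroupM; [exact/subgroupV|exact: subgroupM].
have Hw w : subgroup_set H (eval_word (thompson_X R) w).
  by elim: w => [|i w IHw]; [exact: subgroup1|exact: subgroupM].
by have [w [w' ->]] := thompson_fractions f; exact: subgroupF.
Qed.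

Lemma dyadic_between (c d : R) : 0 <= c -> c < d -> d <= 1 ->
  exists k j : nat, (0 < j < 2 ^ k)%N /\ c < j%:R / 2 ^+ k < d.
Proof.
move=> c0 cd d1; pose k := Num.bound (d - c)^-1.
have dc : 0 < d - c by rewrite subr_gt0.
have kdc : 1 < (d - c) * 2 ^+ k.
  by rewrite mulrC -ltr_pdivrMr// div1r; apply: upper_nthrootP; exact: leqnn.
have pk := exp2_gt0 R k.
(* the first point of the grid beyond [c]; the mesh is less than [d - c] *)
pose j := (Num.truncn (c * 2 ^+ k)).+1.
have /andP[jc cj] : (Num.truncn (c * 2 ^+ k))%:R <= c * 2 ^+ k < j%:R.
  by apply: truncn_itv; rewrite mulr_ge0// ltW.
have jd : j%:R < d * 2 ^+ k by rewrite /j -natr1; lra.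
exists k, j; rewrite ltr_pdivlMr// ltr_pdivrMr// cj jd; split=> //=.
by rewrite -(ltr_nat R) natrX; apply: lt_le_trans jd _; nra.
Qed.

Definition open_unit : set R := [set x | 0 < x < 1].

Lemma x0_map_gt (s : R) : 0 < s < 1 -> s < x0_map s.
Proof.
move=> s01; have [s4|s4] := leP s (1/4); first by rewrite x0_map_low//; lra.
have [s2|s2] := leP s (1/2); first by rewrite x0_map_mid//; lra.
by rewrite x0_map_high//; lra.
Qed.

Lemma thompson_x1_moves (x : R) : 1/2 < x < 1 -> act x1 x <> x.
Proof.
move=> x12; have xE : x = (1 + (2 * x - 1)) / 2 by lra.
rewrite thompson_x1E; last lra.
rewrite {1}xE x1_map_high; last lra.
by have := @x0_map_gt (2 * x - 1); lra.
Qed.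

(** Below [3/4], the first generator moves every point further than the second one. *)
Lemma thompson_u_moves (x : R) : 0 < x < 3/4 -> act u x <> x.
Proof.
(* a fixed point of the quotient is a point where both generators agree *)
move=> x34 /(congr1 (act x1)); rewrite actM actVK.
rewrite thompson_x0E ?thompson_x1E; try lra.
have [x2|x2] := leP x (1/2); first by rewrite x1_map_low//; have := @x0_map_gt x; lra.
rewrite x0_map_high; last lra.
have xE : x = (1 + (2 * x - 1)) / 2 by lra.
rewrite {2}xE x1_map_high; last lra.
have [s4|s4] := leP (2 * x - 1) (1/4); first by rewrite x0_map_low//; lra.
by rewrite x0_map_mid; lra.
Qed.

Lemma thompson_flexible : flexible act open_unit.
Proof.
have std := thompson_standard_pair R.
apply: (@flexible_intro _ _ _ open_unit x1 (1/2) (1/2) u (3/4) (3/4)).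
- by move=> x y z /andP[? ?] /andP[? ?] /andP[? ?]; rewrite /open_unit/=; lra.
- move=> h x /andP[x_gt0 x_lt1]; apply/andP; split.
    by rewrite -[ltLHS](thompson_act0 h) (act_lt act).
  by rewrite -[ltRHS](thompson_act_1 h) (act_lt act).
- move=> h x hx; rewrite /open_unit /=; apply/negPn/negP => x01; apply: hx.
  have [->|xn0] := eqVneq x 0; first exact: thompson_act0.
  have [->|xn1] := eqVneq x 1; first exact: thompson_act_1.
  by apply: thompson_act_out; move: x01 xn0 xn1; rewrite !neq_lt; lra.
- by rewrite /open_unit /=; lra.
- exact: tp_right std.
- by move=> x /andP[_ ?] ?; apply: thompson_x1_moves; apply/andP.
- move=> d /andP[d0 d1]; have [|k [j [jk /andP[_ jd]]]] := dyadic_between (lexx 0) d0; first exact: ltW.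
  by have [g gE] := thompson_dyadic_transitive R jk; exists g; rewrite gE.
- by rewrite /open_unit /=; lra.
- exact: tp_left std.
- by apply: (tp_left std); rewrite lexx.
- by move=> x /andP[? _] ?; apply: thompson_u_moves; apply/andP.
- move=> c d /andP[c0 _] /andP[_ d1] cd.
  have [k [j [jk jcd]]] := dyadic_between (ltW c0) cd (ltW d1).
  have [g gE] := thompson_dyadic_transitive R jk; exists (x0^-1 * g)%g.
  rewrite actM; have -> : 3/4 = act x0 (1/2).
    by rewrite thompson_x0E ?x0_map_high; lra.
  by rewrite actK gE.
Qed.

(** The standard pair deforms to a Thompson pair inside the normal subgroup. *)
Lemma thompson_normal_embeds (N : normalSubgroup F) : subgroup_set N <> [set 1%g] ->
  exists phi : F -> F, [/\ {morph phi : x y / (x * y)%g}, injective phi &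
    forall f, subgroup_set N (phi f)].
Proof.
move=> N1; have D2 : open_unit (1/2) by rewrite /open_unit /=; lra.
have D3 : open_unit (3/4) by rewrite /open_unit /=; lra.
have [a [b [Na Nb ab]]] := normal_thompson_pair thompson_flexible N1 D2 D3 (thompson_standard_pair R).
have [phi [phiM phiI phiN]] := thompson_embeds ab.
by exists phi; split=> // f; exact: phiN.
Qed.

Lemma thompson_infinite : infinite_set [set: F].
Proof.
have std := thompson_standard_pair R.
pose w n := eval_word (thompson_X R) (nseq n 0%N).
have wI : injective w.
  have nseq_sorted n : sorted leq (nseq n 0%N).
    by case: n => //= n; elim: n.
  move=> n m /(thompson_pair_separating std (nseq_sorted n) (nseq_sorted m)).
  by move=> /(congr1 size); rewrite !size_nseq.
move=> finF; apply: infinite_nat; rewrite -(preimage_setT w).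
by apply: finite_preimage finF => n m _ _; exact: wI.
Qed.

Lemma thompson_nonabelian : exists f g : F, (f * g)%g <> (g * f)%g.
Proof.
have std := thompson_standard_pair R.
exists (thompson_X R 1), (thompson_X R 0).
rewrite (thompson_pair_shifting std (isT : (0 < 1)%N)) => e.
have := @thompson_pair_separating _ _ _ _ _ _ _ std [:: 0; 2]%N [:: 0; 1]%N isT isT.
by rewrite /= !mulg1 => /(_ e).
Qed.

End ThompsonEmbedding.

(** * Elementary amenability *)

Section ElementaryAmenability.
Variable R : realType.
Local Open Scope group_scope.
Local Notation F := (thompsonF R : groupType).
Implicit Types (G : groupType).

Lemma subgroup_valM G (K : subgroup G) : {morph (val : K -> G) : x y / x * y}.
Proof. exact: gmulfM. Qed.

Lemma subgroup_val1 G (K : subgroup G) : val (1 : K) = 1.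
Proof. exact: (morph_1 (@subgroup_valM G K)). Qed.

Lemma subgroup_valF G (K : subgroup G) : {morph (val : K -> G) : x y / x / y}.
Proof. exact: (morph_F (@subgroup_valM G K)). Qed.

(** A homomorphism on [H], encoded as a function on the whole group so that no subtype
    is involved. *)
Definition maps_onto_thompson G (H : set G) (phi : G -> F) : Prop :=
  [/\ is_subgroup H, forall x y, H x -> H y -> phi (x * y) = phi x * phi y &
      forall f, exists2 x, H x & phi x = f].

Definition thompson_section G : Prop := exists H phi, @maps_onto_thompson G H phi.

Section PartialMorphism.
Variables (G : groupType) (H : subgroup G) (phi : G -> F).
Hypothesis phiM : forall x y, subgroup_set H x -> subgroup_set H y -> phi (x * y) = phi x * phi y.

Lemma partial_morph1 : phi 1 = 1.
Proof.
apply: (mulgI (phi 1)); rewrite -phiM ?mulg1//; exact: subgroup1.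
Qed.

Lemma partial_morphV x : subgroup_set H x -> phi x^-1 = (phi x)^-1.
Proof.
move=> Hx; apply: (mulgI (phi x)).
by rewrite -phiM ?mulgV ?partial_morph1//; exact: subgroupV.
Qed.

Lemma partial_morphF x y : subgroup_set H x -> subgroup_set H y -> phi (x / y) = phi x / phi y.
Proof. by move=> Hx Hy; rewrite phiM ?partial_morphV//; exact: subgroupV. Qed.

Lemma partial_image_is_subgroup (S : set G) : is_subgroup S -> S `<=` H ->
  is_subgroup (phi @` S).
Proof.
move=> sS SH; split; first by exists 1; [exact: sS.1|exact: partial_morph1].
move=> _ _ [x Sx <-] [y Sy <-]; exists (x / y); first exact: sS.2.
by rewrite partial_morphF//; exact: SH.
Qed.

End PartialMorphism.

Lemma thompson_section_pullback G (Q : groupType) (f : G -> Q) :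
  {morph f : x y / x * y} -> (forall y, exists x, f x = y) ->
  thompson_section Q -> thompson_section G.
Proof.
move=> fM fsurj [H [phi [sH phiM phisurj]]].
exists (f @^-1` H), (phi \o f); split.
- exact: (preimage_is_subgroup fM (Subgroup sH)).
- by move=> x y Hx Hy; rewrite /= fM phiM.
- move=> g; have [y Hy <-] := phisurj g; have [x xy] := fsurj y.
  by exists x; rewrite /preimage /mkset /= xy.
Qed.

Lemma thompson_section_subgroup G (K : subgroup G) :
  thompson_section K -> thompson_section G.
Proof.
move=> [H [phi [sH phiM phisurj]]].
pose into (x : G) : K := insubd (1 : K) x.
have intoK (k : K) : into (val k) = k by rewrite /into valKd.
exists (val @` H), (phi \o into); split.
- exact: (image_is_subgroup (@subgroup_valM _ _) (Subgroup sH)).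
- move=> _ _ [x Hx <-] [y Hy <-] /=.
  by rewrite -subgroup_valM !intoK phiM.
- move=> g; have [x Hx <-] := phisurj g.
  by exists (val x); [exists x|rewrite /= intoK].
Qed.

(** Thompson's group is generated by two elements; lifts of both lie in one member of
    the family. *)
Lemma thompson_section_directed G (D : set (subgroup G)) :
    (forall H K, D H -> D K ->
       exists L, [/\ D L, (H : set G) `<=` L & (K : set G) `<=` L]) ->
    \bigcup_(H in D) (H : set G) = setT ->
    thompson_section G -> exists2 L : subgroup G, D L & thompson_section L.
Proof.
move=> dirD coverD [H [phi [sH phiM phisurj]]].
have [x Hx xE] := phisurj (thompson_x0 R); have [y Hy yE] := phisurj (thompson_x1 R).
have [H1 D1 H1x] : (\bigcup_(H in D) (H : set G)) x by rewrite coverD.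
have [H2 D2 H2y] : (\bigcup_(H in D) (H : set G)) y by rewrite coverD.
have [L [DL H1L H2L]] := dirD _ _ D1 D2.
exists L => //.
pose S : set L := val @^-1` H.
have sS : is_subgroup S := preimage_is_subgroup (@subgroup_valM _ _) (Subgroup sH).
have SM (k l : L) : S k -> S l -> (phi \o val) (k * l) = (phi \o val) k * (phi \o val) l.
  by move=> Sk Sl; rewrite /comp subgroup_valM phiM.
exists S, (phi \o val); split=> // f.
have sI := partial_image_is_subgroup (H := Subgroup sS) SM sS (fun _ => id).
have [||z Sz <-] := @thompson_generated R (Subgroup sI) _ _ f; last by exists z.
- by exists (exist _ x (mem_set (H1L _ H1x))).
- by exists (exist _ y (mem_set (H2L _ H2y))).
Qed.

(** Let [S] be the part of [H] inside [N].  If [phi] kills [S], it factors through the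
    quotient.  Otherwise the image of [S] is a nontrivial normal subgroup of Thompson's
    group and contains a copy of it; its preimage in [S] maps onto Thompson's group. *)
Lemma thompson_section_extension G (N : normalSubgroup G) :
  thompson_section G -> thompson_section N \/ thompson_section (quotientGroup N).
Proof.
move=> [H [phi [sH phiM phisurj]]]; set HH := Subgroup sH.
pose pi := @quotient_map G N.
have [kills|nkills] := pselect (forall x, H x -> subgroup_set N x -> phi x = 1); [right|left].
  (* preimages in [H] of the elements of its image in the quotient *)
  have /choice[sigma sigmaE] : forall z, exists x,
      (exists2 y, H y & pi y = z) -> H x /\ pi x = z.
    move=> z; have [[y Hy yz]|nz] := pselect (exists2 y, H y & pi y = z).
      by exists y.
    by exists 1 => /nz.
  have phi_pi x y : H x -> H y -> pi x = pi y -> phi x = phi y.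
    move=> Hx Hy xy; apply/divg1_eq; rewrite -(partial_morphF (H := HH) phiM)//.
    apply: kills; first exact: sH.2.
    by apply/quotient_map_eq1; rewrite (morph_F (@quotient_mapM _ N)) -/(pi x) xy mulgV.
  have sigma_pi x : H x -> phi (sigma (pi x)) = phi x.
    move=> Hx; have [|Hs ps] := sigmaE (pi x); first by exists x.
    exact: phi_pi.
  exists (pi @` H), (phi \o sigma); split.
  - exact: (image_is_subgroup (@quotient_mapM _ N) HH).
  - move=> _ _ [x Hx <-] [y Hy <-] /=; rewrite -(@quotient_mapM _ N x y) !sigma_pi ?phiM//.
    exact: (subgroupM (H := HH)).
  - by move=> f; have [x Hx <-] := phisurj f; exists (pi x); [exists x|exact: sigma_pi].
pose S : set G := [set x | H x /\ subgroup_set N x].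
have sS : is_subgroup S.
  split; first by split; [exact: sH.1|exact: subgroup1].
  by move=> x y [Hx Nx] [Hy Ny]; split; [exact: sH.2|exact: subgroupF].
have sM := partial_image_is_subgroup (H := HH) phiM sS (fun x => @proj1 _ _).
have nM : is_normal (phi @` S).
  move=> _ f [x [Hx Nx] <-]; have [y Hy <-] := phisurj f.
  exists (x ^ y).
    split; last exact: Defs.normalP.
    apply: (subgroupM (H := HH)); first exact: (subgroupV (H := HH)).
    exact: (subgroupM (H := HH)).
  rewrite /conjg !phiM ?(partial_morphV (H := HH) phiM)//.
    exact: (subgroupV (H := HH)).
  exact: (subgroupM (H := HH)).
pose M : normalSubgroup F := @NormalSubgroup F (Subgroup sM) nM.
have M1 : subgroup_set M <> [set 1].
  move=> M1; apply: nkills => x Hx Nx; suff : [set 1] (phi x) by [].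
  by rewrite -M1; exists x.
have [psi [psiM psiI psiN]] := thompson_normal_embeds M1.
pose T : set N := [set n | H (val n) /\ exists f, psi f = phi (val n)].
have /choice[tau tauE] : forall n : N, exists f, T n -> psi f = phi (val n).
  by move=> n; have [[_ [f fE]]|nT] := pselect (T n); [exists f|exists 1].
exists T, tau; split.
- split.
    split; first by rewrite subgroup_val1; exact: sH.1.
    by exists 1; rewrite subgroup_val1 (morph_1 psiM) (partial_morph1 (H := HH) phiM).
  move=> m n [Hm [f fE]] [Hn [g gE]]; split; first by rewrite subgroup_valF; exact: sH.2.
  by exists (f / g); rewrite subgroup_valF (morph_F psiM) (partial_morphF (H := HH) phiM)// fE gE.
- move=> m n Tm Tn; apply: psiI; rewrite psiM !tauE//.
    by rewrite subgroup_valM phiM//; [case: Tm|case: Tn].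
  case: Tm Tn => [Hm [f fE]] [Hn [g gE]]; split.
    by rewrite subgroup_valM; exact: (subgroupM (H := HH)).
  by exists (f * g); rewrite subgroup_valM psiM phiM// fE gE.
- move=> f; have [x [Hx Nx] xE] := psiN f.
  have Tx : T (exist _ x (mem_set Nx)) by split=> //; exists f.
  by exists (exist _ x (mem_set Nx)) => //; apply: psiI; rewrite tauE.
Qed.

(** Induction on the construction of the group.  A finite or an abelian group has only
    finite, respectively abelian, sections. *)
Lemma elementary_amenable_no_section G :
  elementary_amenable G -> ~ thompson_section G.
Proof.
elim=> {G}.
- move=> G finG [H [phi [_ _ phisurj]]]; apply: (@thompson_infinite R).
  have -> : [set: F] = phi @` setT.
    by rewrite eqEsubset; split=> // f _; have [x _ <-] := phisurj f; exists x.
  exact: finite_image.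
- move=> G abG [H [phi [sH phiM phisurj]]].
  have [f [g]] := thompson_nonabelian R.
  have [x Hx <-] := phisurj f; have [y Hy <-] := phisurj g.
  by rewrite -!phiM// abG.
- move=> G H [f [f' fK f'K]] _ nG sH; apply: nG.
  by apply: (thompson_section_pullback (f := f)) sH => [|y]; [exact: gmulfM|exists (f' y)].
- by move=> G H _ nG /thompson_section_subgroup.
- move=> G N _ nG; apply: contra_not nG.
  exact: (thompson_section_pullback (@quotient_mapM _ N) (@quotient_map_surj _ N)).
- by move=> G N _ nN _ nQ /(@thompson_section_extension _ N)[].
- move=> G D dirD coverD _ nD /(thompson_section_directed dirD coverD)[L DL].
  exact: nD.
Qed.

Lemma thompson_subgroup_section G (phi : F -> G) :
  {morph phi : x y / x * y} -> injective phi -> thompson_section G.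
Proof.
move=> phiM phiI.
have /choice[psi psiE] : forall x, exists f, (exists g, phi g = x) -> phi f = x.
  by move=> x; have [[g gx]|nx] := pselect (exists g, phi g = x); [exists g|exists 1].
have psiK : cancel phi psi by move=> f; apply: phiI; apply: psiE; exists f.
exists (range phi), psi; split.
- exact: (image_is_subgroup phiM (Subgroup (full_is_subgroup _))).
- by move=> _ _ [f _ <-] [g _ <-]; rewrite -phiM !psiK.
- by move=> f; exists (phi f); [exists f|].
Qed.

Lemma embedding_isomorphic (L G : groupType) (phi : L -> G) :
  {morph phi : x y / x * y} -> injective phi ->
  exists H : subgroup G, isomorphic H L.
Proof.
move=> phiM phiI; pose H := Subgroup (image_is_subgroup phiM (Subgroup (full_is_subgroup L))).
have /choice[psi psiE] : forall x : H, exists f, phi f = val x.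
  by move=> x; have [f _ fx] := set_mem (valP x); exists f.
have psiM : {morph psi : x y / x * y}.
  by move=> x y; apply: phiI; rewrite phiM !psiE subgroup_valM.
pose psiI := isMultiplicative.Build H L psi psiM.
pose psi' : {multiplicative H -> L} := HB.pack psi psiI.
have phiH f : phi f \in (H : set G) by apply: mem_set; exists f.
exists H, psi'; exists (fun f => exist _ (phi f) (phiH f)).
- by move=> x; apply: val_inj; rewrite /= psiE.
- by move=> f; apply: phiI; rewrite /= psiE.
Qed.

End ElementaryAmenability.

(** * Groups that admit a coherent action *)

Theorem theorem1p1 (R : realType) (G : groupType) (hG : class_C R G) :
  [/\ [/\ exists H : subgroup G, isomorphic H (thompsonF R),
          ~ elementary_amenable G &
          ~ solvable G],
      exists n : nat, forall N : normalSubgroup G,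
        subgroup_set N <> [set 1%g] -> solvable_of_degree_le (quotientGroup N) n &
      exists n : nat, simple (derived G n)].
Proof.
case: hG => B [cohB [f f_bij]].
have fM : {morph f : x y / (x * y)%g} by exact: gmulfM.
have [u [v [p [q uv]]]] := coherent_thompson_pair fM f_bij cohB.
have [phi [phiM phiI _]] := thompson_embeds uv.
have flexG := coherent_flexible fM f_bij cohB.
have G1 : [set: G] <> [set 1%g].
  move=> G1; have [x [y]] := thompson_nonabelian R; apply; apply: phiI.
  have triv (g : G) : g = 1%g by have : [set: G] g by []; rewrite G1.
  by rewrite (triv (phi (x * y)%g)) (triv (phi (y * x)%g)).
have [k kc] := coherent_derived_compact fM f_bij cohB.
split; first split.
- exact: embedding_isomorphic phiM phiI.
- move=> /(@elementary_amenable_no_section R); apply.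
  exact: thompson_subgroup_section phiM phiI.
- exact: flex_not_solvable flexG G1.
- by exists k.+1 => N N1; exact: (flex_quotient_solvable flexG kc).
- by exists k.+1; exact: (flex_simple flexG G1 kc).
Qed.
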